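(* There exist a sequence of Hilbert spaces $(H_n)_{n\in\mathbb N}$, bounded operators $A_n\in\mathcal L(H_n)$, $n\in\mathbb N$, and a $C_0$-sequence $\boldsymbol y=(y_n)_{n\in\mathbb N}\in\times_{n\in\mathbb N}H_n$ such that the following holds. (i) $\bigotimes_{n\in\mathbb N}^{\boldsymbol y}A_n=\widehat\bigotimes_{n\in\mathbb N}^{\boldsymbol y}A_n=0$ (both being well-defined, in the factorwise and in the strong-limit sense respectively). (ii) The complete tensor product $\bigotimes_{n\in\mathbb N}A_n$ is well-defined and nonzero. Consequently, $\bigl\|\bigotimes_{n\in\mathbb N}^{\boldsymbol y}A_n\bigr\|\ne\prod_{n\in\mathbb N}\|A_n\|$.
   Context: Hilbert spaces are complex; $\mathcal L(H)$ denotes the bounded operators on $H$. Products: for $(z_n)\subset\mathbb C$, $\prod_nz_n$ converges unconditionally to $a\in\mathbb C$ if $\lim_{N\to\infty}\prod_{n=1}^Nz_{\sigma(n)}=a$ for every bijection $\sigma:\mathbb N\to\mathbb N$. Infinite products are understood unconditionally. $\prod_nz_n$ is quasi-convergent if $\prod_n|z_n|$ converges unconditionally to a finite value; its value is then the unconditional limit of $\prod_nz_n$ if it exists and $0$ otherwise. Tensor products of spaces: $(h_n)\in\times_nH_n$ is a $C$-sequence if $\prod_n\|h_n\|$ converges unconditionally to a finite value. For a $C$-sequence $(h_n)$ the elementary tensor $\bigotimes_nh_n$ is the functional $(f_n)\mapsto\prod_n\langle h_n,f_n\rangle$ (quasi-convergent product) on the set of $C$-sequences. The complete tensor product $\bigotimes_nH_n$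 is the completion of the linear span of elementary tensors with inner product determined by $\langle\bigotimes_nh_n,\bigotimes_nf_n\rangle=\prod_n\langle h_n,f_n\rangle$. A $C$-sequence is a $C_0$-sequence if $\sum_n|1-\|h_n\||<\infty$; two $C_0$-sequences are equivalent if $\sum_n|1-\langle h_n,f_n\rangle|<\infty$ (an equivalence relation). For a $C_0$-sequence $\boldsymbol y$, the incomplete tensor product $\bigotimes_n^{\boldsymbol y}H_n$ is the closed linear span in $\bigotimes_nH_n$ of the $\bigotimes_nh_n$ with $(h_n)$ a $C_0$-sequence equivalent to $\boldsymbol y$. Tensor products of operators $A_n\in\mathcal L(H_n)$: $\bigotimes_nA_n$ (complete) is well-defined if for every elementary tensor $\bigotimes_nh_n$ in $\bigotimes_nH_n$ also $\bigotimes_nA_nh_n$ is an elementary tensor, and $\bigotimes_nh_n\mapsto\bigotimes_nA_nh_n$ extends linearly to a bounded operator on $\bigotimes_nH_n$. $\bigotimes_n^{\boldsymbol y}A_n$ is well-defined in the factorwise sense if for every elementary tensor $\bigotimes_nh_n\in\bigotimes_n^{\boldsymbol y}H_n$, $\bigotimes_nA_nh_n$ is an elementary tensor in $\bigotimes_n^{\boldsymbol y}H_n$, and $\bigotimes_nh_n\mapsto\bigotimes_nA_nh_n$ extends linearly to a bounded operator on $\bigotimes_n^{\boldsymbol y}H_n$. For finite $F\subset\mathbb N$ let $A_F^{(\boldsymbol y)}$ be the operator $(\bigotimes_{n\in F}A_n)\otimes I$ on $\bigotimes_n^{\boldsymbol y}H_n\simeq(\bigotimes_{n\in F}H_n)\otimes(\bigotimes_{n\notin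 F}^{(y_n)_{n\notin F}}H_n)$. $\widehat\bigotimes_n^{\boldsymbol y}A_n$ is well-defined in the strong-limit sense if the net $(A_F^{(\boldsymbol y)})_F$ over finite $F\subset\mathbb N$ ordered by inclusion converges strongly to a bounded operator, which is then denoted $\widehat\bigotimes_n^{\boldsymbol y}A_n$. *)

(* Defs.v *)
(* Hilbert spaces are defined over any [K : numClosedFieldType]; complex ones
   are obtained for [K := R[i]] with [R : realType].  Inner products are linear
   in their first argument. *)
From HB Require Import structures.
From mathcomp Require Export all_boot all_order all_algebra.
From mathcomp Require Export sesquilinear complex finmap.
From mathcomp Require Export all_classical all_reals topology normedtype.
From mathcomp Require Export sequences summability.

Set Implicit Arguments.
Unset Strict Implicit.
Unset Printing Implicit Defensive.

Import Order.TTheory GRing.Theory Num.Theory.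
Export numFieldNormedType.Exports.

Local Open Scope classical_set_scope.
Local Open Scope ring_scope.

HB.mixin Record CompleteNormedModule_isHilbert (K : numClosedFieldType) V
    of CompleteNormedModule K V := {
  hdot : {dot V for (@Num.conj K)} ;
  hdot_normE : forall x : V, `|x| ^+ 2 = hdot x x }.

#[short(type="hilbertType")]
HB.structure Definition Hilbert (K : numClosedFieldType) :=
  {V of CompleteNormedModule K V & CompleteNormedModule_isHilbert K V}.

Notation "<[ x , y ]>" := (hdot x y) (format "<[ x ,  y ]>") : ring_scope.

Definition linear_span (K : numFieldType) (V : lmodType K) (A : set V) : set V :=
  [set v | exists (n : nat) (c : 'I_n -> K) (a : 'I_n -> V),
    (forall i, A (a i)) /\ v = \sum_(i < n) c i *: a i].

Section operators.
Variables (K : numFieldType) (V : normedModType K).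

(* [L] is a bounded linear operator on the subspace [S]; the values of [L]
   outside [S] are irrelevant. *)
Definition bounded_operator (S : set V) (L : V -> V) : Prop :=
  [/\ forall x, S x -> S (L x),
      forall (a : K) x y, S x -> S y -> L (a *: x + y) = a *: L x + L y
    & exists M : K, forall x, S x -> `|L x| <= M * `|x| ].

End operators.

(* In a normed space over [R[i]] the library's norm takes (nonnegative real)
   values in [R[i]]. *)
Definition operator_norm (R : realType) (V : normedModType R[i])
    (S : set V) (L : V -> V) : R :=
  sup [set complex.Re `|L x| | x in [set x | S x /\ `|x| <= 1]].

Section products.
Variable K : numFieldType.

Definition uprod_cvg (z : nat -> K) (a : K) : Prop :=
  forall s : nat -> nat, bijective s ->
    (fun N => \prod_(n < N) z (s n)) @ \oo --> a.

Definition quasi_convergent (z : nat -> K) : Prop :=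
  exists a : K, uprod_cvg (fun n => `|z n|) a.

(* Meaningful for quasi-convergent products only. *)
Definition qprod (z : nat -> K) : K := xget 0 [set a | uprod_cvg z a].

End products.

Section tensor.
Variables (K : numClosedFieldType) (H : nat -> hilbertType K).
Implicit Types h f y : forall n, H n.

Definition C_sequence h : Prop := quasi_convergent (fun n => `|h n|).

Definition C0_sequence h : Prop :=
  C_sequence h /\ cvgn (series (fun n => `|1 - `|h n| |)).

Definition C0_equiv h f : Prop := cvgn (series (fun n => `|1 - <[h n, f n]>|)).

Definition Cseq : Type := {h : forall n, H n | C_sequence h}.

Definition elementary_tensor h : Cseq -> K^o :=
  fun u => qprod (fun n => <[h n, sval u n]>).

Definition tensor_span : set (Cseq -> K^o) :=
  linear_span [set elementary_tensor h | h in C_sequence].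

(* A completion of [tensor_span] for the inner product determined by
   <⊗h, ⊗f> = ∏ <h_n, f_n>.  The values of [ct_incl] outside [tensor_span]
   are irrelevant; [ct_incl] is injective on [tensor_span], because
   Φ f = <ct_incl Φ, ct_incl (⊗f)> for Φ in [tensor_span]. *)
Record complete_tensor := CompleteTensor {
  ct_space :> hilbertType K ;
  ct_incl : (Cseq -> K^o) -> ct_space ;
  ct_incl_linear : forall (a : K) (Phi Psi : Cseq -> K^o),
    tensor_span Phi -> tensor_span Psi ->
    ct_incl (a *: Phi + Psi) = a *: ct_incl Phi + ct_incl Psi ;
  ct_inclE : forall h f, C_sequence h -> C_sequence f ->
    <[ct_incl (elementary_tensor h), ct_incl (elementary_tensor f)]>
      = qprod (fun n => <[h n, f n]>) ;
  ct_dense : dense (ct_incl @` tensor_span) }.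

Variable T : complete_tensor.

Definition tens h : T := ct_incl T (elementary_tensor h).

Definition incomplete_tensor y : set T :=
  closure (linear_span [set tens h | h in [set h | C0_sequence h /\ C0_equiv h y]]).

Variable A : forall n, H n -> H n.

(* [L] is the tensor product, in the factorwise sense, of the operators [A n]
   on the closed subspace [S]. *)
Definition factorwise_tensor_op (S : set T) (L : T -> T) : Prop :=
  [/\ forall h, C_sequence h -> S (tens h) ->
        C_sequence (fun n => A (h n)) /\ S (tens (fun n => A (h n))),
      bounded_operator S L
    & forall h, C_sequence h -> S (tens h) ->
        L (tens h) = tens (fun n => A (h n))].

Definition complete_tensor_op (L : T -> T) : Prop :=
  factorwise_tensor_op [set: T] L.

Definition incomplete_tensor_op y (L : T -> T) : Prop :=
  factorwise_tensor_op (incomplete_tensor y) L.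

(* [L] is the operator (⊗_{n in F} A_n) ⊗ I on the incomplete tensor product
   along [y], under the identification of ⊗h with
   (⊗_{n in F} h_n) ⊗ (⊗_{n notin F} h_n). *)
Definition finite_tensor_op y (F : {fset nat}) (L : T -> T) : Prop :=
  bounded_operator (incomplete_tensor y) L /\
  forall h, C0_sequence h -> C0_equiv h y ->
    L (tens h) = tens (fun n => if n \in F then A (h n) else h n).

Definition strong_limit_tensor_op y (L : T -> T) : Prop :=
  bounded_operator (incomplete_tensor y) L /\
  exists B : {fset nat} -> T -> T,
    (forall F, finite_tensor_op y F (B F)) /\
    (forall x, incomplete_tensor y x -> B F x @[F --> totally] --> L x).

End tensor.

(* Main.v *)
From HB Require Import structures.
From mathcomp Require Import ring lra.
Require Import Defs.

Set Implicit Arguments.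
Unset Strict Implicit.
Unset Printing Implicit Defensive.

Import Order.TTheory GRing.Theory Num.Theory.

Local Open Scope classical_set_scope.
Local Open Scope ring_scope.

(** All [H n] are one plane with orthonormal basis [e1], [e2]; [A n] is the
    orthogonal projection [line_proj] to the line of [e1], and [y n = e2].  If
    [f] is a C_0-sequence equivalent to [y], then [f n] approaches [e2], so from
    some index on [A n] at least halves the squared norm of [f n]
    ([line_proj_half]), and each further projected factor halves the squared
    norm of the tensor ([tens_line_proj_decay]).  The products over finite sets
    are contractions, so they tend strongly to 0 along [y]
    ([tensor_contraction_small]), and the product over all indices vanishes
    there too.  On the complete tensor product the product of the [A n] is
    again an orthogonal projection ([tensor_line_proj]); it fixes the tensor of
    the constant sequence [e1], hence is not 0.  All the [A n] have norm 1.

    Most of the work goes into the existence of a complete tensor product.  The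
    elementary tensor of [h] is the function [k h] of the kernel
    [k h u = \prod_n <h n, u n>] on C-sequences, and the inner product of two of
    them is a value of [k].  So the completion is the reproducing kernel Hilbert
    space [rkhs] of [k], provided that [k] is positive ([psd_tensor_kernel]).
    Between sequences that are not equivalent [k] vanishes
    ([qprod_hdot_neq0]), because a product that converges unconditionally to a
    nonzero value converges absolutely ([uprod_cvg_abs]); within an equivalence
    class [k] is a limit of finite products of inner products, and positivity
    survives products with rank-one kernels, sums, limits and the restriction to
    equivalent pairs.  The plane itself is obtained in the same way, from the
    identity kernel on [bool] ([orthonormal_pair]). *)

(** * Rearrangements *)

Section Blocks.
Variable f : nat -> seq nat.
Hypothesis f_uniq : forall m, uniq (f m).
Hypothesis f_sub : forall m, {subset iota 0 m <= f m}.

(* From this index on the sets of the family contain [k] and all of [b]. *)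
Let bound k (b : seq nat) := maxn k.+1 (\max_(x <- b) x).+1.

Fixpoint block k : seq nat :=
  if k is k'.+1 then
    block k' ++ [seq x <- f (bound k' (block k')) | x \notin block k']
  else [::].

Lemma block_uniq k : uniq (block k).
Proof.
elim: k => //= k IH; rewrite cat_uniq IH filter_uniq //= andbT.
by apply/hasPn => x; rewrite mem_filter => /andP[].
Qed.

Lemma perm_block k : perm_eq (block k.+1) (f (bound k (block k))).
Proof.
apply: uniq_perm => //; first exact: block_uniq.
move=> x; rewrite mem_cat mem_filter; have [xb|//] := boolP (x \in block k).
rewrite /=; apply/esym/f_sub; rewrite mem_iota /= add0n /bound leq_max.
by rewrite ltnS; apply/orP; right; apply: leq_bigmax_seq.
Qed.

Lemma block_size k : (k <= size (block k))%N.
Proof.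
case: k => // k; rewrite (perm_size (perm_block k)).
apply: leq_trans (uniq_leq_size (iota_uniq 0 _) (@f_sub _)).
by rewrite size_iota /bound leq_max leqnn.
Qed.

Lemma nth_block i j n : (n < size (block i))%N -> (n < size (block j))%N ->
  nth 0%N (block i) n = nth 0%N (block j) n.
Proof.
wlog ij : i j / (i <= j)%N => [W|].
  by have [/W|/ltnW ji] := leqP i j => // *; rewrite (W j i).
move=> ni _; elim: j ij => [|j IH]; first by rewrite leqn0 => /eqP->.
rewrite leq_eqVlt => /predU1P[->//|]; rewrite ltnS => ij.
rewrite (IH ij) /= nth_cat ifT //.
apply: leq_trans ni _; elim: j ij {IH} => [|j IH].
  by rewrite leqn0 => /eqP->.
rewrite leq_eqVlt => /predU1P[->//|]; rewrite ltnS => /IH/leq_trans -> //.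
by rewrite /= size_cat leq_addr.
Qed.

End Blocks.

(** Any family of finite sets that exhausts [nat] occurs, up to order, among the
    initial segments of one rearrangement: the sets are enumerated one after the
    other, each one far enough in the family to contain all that precede. *)
Lemma rearrangement_through (f : nat -> seq nat) :
    (forall m, uniq (f m)) -> (forall m, {subset iota 0 m <= f m}) ->
  exists2 s : nat -> nat, bijective s &
    forall k, exists2 N, (k <= N)%N & exists m, perm_eq (map s (iota 0 N)) (f m).
Proof.
move=> fu fs; pose b := block f.
have bS n : (n < size (b n.+1))%N by apply: block_size.
pose s n := nth 0%N (b n.+1) n.
have sE n k : (n < size (b k))%N -> s n = nth 0%N (b k) n.
  by move=> nk; apply: nth_block.
have sinj : injective s.
  move=> i j; wlog ij : i j / (i <= j)%N => [W|].
    by have [/W|/ltnW/W W'] := leqP i j => // /esym/W'.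
  have ib : (i < size (b j.+1))%N by apply: leq_ltn_trans ij (bS j).
  rewrite (sE i _ ib) => /eqP; rewrite nth_uniq ?block_uniq //; first by move/eqP.
exists s.
  have mb x : x \in b x.+1.
    rewrite (perm_mem (perm_block fu fs x)); apply: fs.
    by rewrite mem_iota add0n leq_max leqnn.
  exists (fun x => index x (b x.+1)) => x.
    by apply: sinj; rewrite (sE _ (s x).+1) ?nth_index ?index_mem.
  by rewrite (sE _ x.+1) ?nth_index ?index_mem.
move=> k; exists (size (b k.+1)); first exact/ltnW/block_size.
eexists; apply: perm_trans (perm_block fu fs k).
rewrite (_ : map _ _ = b k.+1) ?perm_refl //.
apply: (@eq_from_nth _ 0%N); rewrite size_map size_iota // => i ib.
by rewrite (nth_map 0%N) ?size_iota // nth_iota // add0n (sE _ k.+1).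
Qed.

(** * Limits and unconditional products *)

Lemma cvgn_distP (K : numFieldType) (V : normedModType K) (u : nat -> V) (l : V) :
  u @ \oo --> l <->
  forall e : K, 0 < e -> exists N, forall n, (N <= n)%N -> `|l - u n| < e.
Proof.
split=> [/cvgrPdist_lt H e /H [N _ HN]|H]; first by exists N => n /HN.
by apply/cvgrPdist_lt => e /H[N HN]; exists N.
Qed.

Lemma cvgn_unique (K : numFieldType) (V : normedModType K) (u : nat -> V) (a b : V) :
  u @ \oo --> a -> u @ \oo --> b -> a = b.
Proof. by move=> ua ub; apply: cvg_unique ua ub; exact: norm_hausdorff. Qed.

Lemma cvgn_sum (K : numFieldType) (I : Type) (r : seq I) (F : nat -> I -> K)
    (a : I -> K) :
  (forall i, (F ^~ i) @ \oo --> a i) ->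
  (fun n => \sum_(i <- r) F n i) @ \oo --> \sum_(i <- r) a i.
Proof.
move=> Fa; elim: r => [|i r IH].
  rewrite big_nil (_ : (fun n => _) = cst 0); first exact: cvg_cst.
  by apply/funext => n; rewrite big_nil.
rewrite big_cons (_ : (fun n => _) = fun n => F n i + \sum_(j <- r) F n j).
  exact: cvgD.
by apply/funext => n; rewrite big_cons.
Qed.

Lemma cvgn_ge0 (K : numFieldType) (u : nat -> K) a :
  u @ \oo --> a -> (forall n, 0 <= u n) -> 0 <= a.
Proof.
move=> ua u0; suff -> : a = `|a| by [].
have E : (fun n => `|u n|) = u by apply/funext => n; rewrite ger0_norm.
by apply: (cvgn_unique ua); rewrite -[X in X @ _]E; apply: cvg_norm.
Qed.

Lemma cvgn_ge (K : numFieldType) (u : nat -> K) a b :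
  u @ \oo --> a -> (forall n, b <= u n) -> b <= a.
Proof.
move=> ua bu; rewrite -subr_ge0; apply: (@cvgn_ge0 _ (fun n => u n - b)).
  by apply: cvgB ua _; apply: cvg_cst.
by move=> n; rewrite subr_ge0.
Qed.

Lemma cvgn_le (K : numFieldType) (u : nat -> K) a b :
  u @ \oo --> a -> (forall n, u n <= b) -> a <= b.
Proof.
move=> ua ub; rewrite -subr_ge0; apply: (@cvgn_ge0 _ (fun n => b - u n)).
  by apply: cvgB _ ua; apply: cvg_cst.
by move=> n; rewrite subr_ge0.
Qed.

Lemma cauchy_seq_cvg (K : numFieldType) (V : completeNormedModType K) (u : nat -> V) :
  (forall e : K, 0 < e -> exists N, forall n, (N <= n)%N -> `|u N - u n| < e) ->
  cvgn u.
Proof.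
move=> H; apply/cauchy_cvgP/cauchy_exP => e /H[N HN].
by exists (u N); exists N => // n /HN; rewrite -ball_normE.
Qed.

Section NetProducts.
Variable K : numFieldType.
Implicit Types (z : nat -> K) (a : K).

Definition net_prod_cvg z a :=
  forall e, 0 < e -> exists m, forall s : seq nat,
    uniq s -> {subset iota 0 m <= s} -> `|a - \prod_(n <- s) z n| < e.

Lemma prod_mapE z (s : nat -> nat) N :
  \prod_(n < N) z (s n) = \prod_(n <- map s (iota 0 N)) z n.
Proof. by rewrite big_map -(big_mkord xpredT (z \o s)) /index_iota subn0. Qed.

(** Products over all rearrangements converge together only if the products over
    large finite sets do: otherwise infinitely many sets with a bad product fit
    into one rearrangement, by [rearrangement_through]. *)
Lemma uprod_cvgP z a : uprod_cvg z a <-> net_prod_cvg z a.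
Proof.
split=> [za|za s sbij]; last first.
  apply/cvgn_distP => e /za[m Hm].
  case: (sbij) => g sK gK; exists (\max_(i < m) (g i).+1)%N => n hn.
  rewrite (prod_mapE z s); apply: Hm.
    by rewrite map_inj_uniq ?iota_uniq //; apply: can_inj sK.
  move=> x; rewrite mem_iota add0n => /= xm; apply/mapP; exists (g x) => //.
  rewrite mem_iota /= add0n; apply: leq_trans hn.
  exact: (@leq_bigmax _ (fun i : 'I_m => (g i).+1) (Ordinal xm)).
move=> e e0; apply: contrapT => /forallNP H.
have /choice[f Hf] : forall m, exists s : seq nat,
    [/\ uniq s, {subset iota 0 m <= s} & ~ `|a - \prod_(n <- s) z n| < e].
  move=> m; have /existsNP[s /not_implyP[us /not_implyP[ms E]]] := H m.
  by exists s.
have [s sbij Hs] := @rearrangement_through f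
  (fun m => let: And3 u _ _ := Hf m in u) (fun m => let: And3 _ u _ := Hf m in u).
have /cvgn_distP/(_ e e0)[N HN] := za s sbij.
have [M /HN + [m Pm]] := Hs N.
by rewrite (prod_mapE z s) (perm_big _ Pm); case: (Hf m).
Qed.

Lemma uprod_cvg_seq z a : uprod_cvg z a ->
  (fun N => \prod_(n < N) z n) @ \oo --> a.
Proof. by move=> za; apply: (za id); exists id. Qed.

Lemma uprod_cvg_unique z a b : uprod_cvg z a -> uprod_cvg z b -> a = b.
Proof. by move=> /uprod_cvg_seq za /uprod_cvg_seq; apply: cvgn_unique. Qed.

Lemma qprodE z a : uprod_cvg z a -> qprod z = a.
Proof. by move=> za; apply: xget_unique => // b /uprod_cvg_unique; apply. Qed.

Lemma uprod_cvgM z w a b :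
  uprod_cvg z a -> uprod_cvg w b -> uprod_cvg (fun n => z n * w n) (a * b).
Proof.
move=> za wb s sb; under eq_fun do rewrite big_split /=.
by apply: cvgM; [apply: za|apply: wb].
Qed.

Lemma uprod_cvg0_dominated z w : uprod_cvg w 0 -> (forall n, `|z n| <= `|w n|) ->
  uprod_cvg z 0.
Proof.
move=> w0 zw s sb; have /cvgn_distP H := w0 s sb.
apply/cvgn_distP => e /H[N HN]; exists N => n /HN; apply: le_lt_trans.
rewrite !sub0r !normrN !normr_prod; apply: ler_prod => i _.
by rewrite normr_ge0 zw.
Qed.

End NetProducts.

(** * Sequences of complex numbers *)

Lemma invS_gt0 (K : numFieldType) n : 0 < n.+1%:R^-1 :> K.
Proof. by rewrite invr_gt0 ltr0Sn. Qed.

Lemma invS_le (K : numFieldType) n m : (n <= m)%N ->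
  m.+1%:R^-1 <= n.+1%:R^-1 :> K.
Proof. by move=> nm; rewrite lef_pV2 ?posrE ?ltr0Sn // ler_nat. Qed.

Section ComplexSequences.
Local Open Scope complex_scope.
Variable R : realType.
Local Notation C := (Num.NumField.sort (R[i] : numFieldType)).
Implicit Types (u w : nat -> C).

Lemma ReB (x y : C) : complex.Re (x - y) = complex.Re x - complex.Re y.
Proof. by case: x y => ? ? [? ?]. Qed.

Lemma ImB (x y : C) : complex.Im (x - y) = complex.Im x - complex.Im y.
Proof. by case: x y => ? ? [? ?]. Qed.

Lemma normc_ge_Im (x : C) : `|complex.Im x|%:C <= `|x|.
Proof.
have := normc_ge_Re (x * 'i); rewrite ReiNIm normrN normrM.
by rewrite [X in _ * X](_ : _ = 1) ?mulr1 // normc_def /= expr0n expr1n add0r sqrtr1.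
Qed.

Lemma normc_le_ReIm (x : C) : `|x| <= (`|complex.Re x| + `|complex.Im x|)%:C.
Proof.
rewrite {1}[x]complexE (le_trans (ler_normD _ _)) // rmorphD lerD //.
  by rewrite normc_def /= expr0n addr0 sqrtr_sqr.
rewrite normrM [X in X * _](_ : _ = 1) ?mul1r; last first.
  by rewrite normc_def /= expr0n expr1n add0r sqrtr1.
by rewrite normc_def /= expr0n addr0 sqrtr_sqr.
Qed.

Lemma gt0_real (e : C) : 0 < e -> 0 < complex.Re e /\ e = (complex.Re e)%:C.
Proof. by case: e => a b; rewrite ltcE /= => /andP[/eqP-> ->]. Qed.

Lemma invS_small (e : C) : 0 < e ->
  exists N, forall n, (N <= n)%N -> n.+1%:R^-1 < e.
Proof.
move=> /gt0_real[e0 ->].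
have /cvgn_distP/(_ _ e0)[N HN] := @cvg_harmonic R.
exists N => n /HN; rewrite sub0r normrN ger0_norm ?harmonic_ge0 // -ltcR.
by rewrite fmorphV rmorph_nat.
Qed.

Lemma complex_cvg u (a b : R) :
  (fun n => complex.Re (u n)) @ \oo --> a ->
  (fun n => complex.Im (u n)) @ \oo --> b -> u @ \oo --> (a +i* b : C).
Proof.
move=> /cvgn_distP ua /cvgn_distP ub; apply/cvgn_distP => e /gt0_real[e0 ->].
have e20 : 0 < complex.Re e / 2 by rewrite divr_gt0.
have [N HN] := ua _ e20; have [M HM] := ub _ e20.
exists (maxn N M) => n; rewrite geq_max => /andP[/HN Hn /HM Hm].
apply: le_lt_trans (normc_le_ReIm _) _; rewrite ltcR ReB ImB /=.
by rewrite [ltRHS]splitr ltrD.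
Qed.

Lemma cauchy_seq_cvg_complex u :
  (forall e : C, 0 < e -> exists N, forall n, (N <= n)%N -> `|u N - u n| < e) ->
  cvgn u.
Proof.
move=> H; have HR (f : C -> R) : (forall x y, f (x - y) = f x - f y) ->
    (forall x, `|f x|%:C <= `|x|) -> cvgn (fun n => f (u n)).
  move=> fB fn; apply: cauchy_seq_cvg => e e0.
  have [|N HN] := H e%:C; first by rewrite ltcR.
  by exists N => n /HN; rewrite -ltcR -fB; apply: le_lt_trans.
have /cvg_ex[a ua] := HR _ ReB (@normc_ge_Re _).
have /cvg_ex[b ub] := HR _ ImB normc_ge_Im.
by apply/cvg_ex; exists (a +i* b); apply: complex_cvg.
Qed.

Lemma nonincreasing_cvg_complex u :
  (forall n, 0 <= u n) -> (forall n, u n.+1 <= u n) -> cvgn u.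
Proof.
move=> u0 ud.
have /cvg_ex[a ua] : cvgn (fun n => complex.Re (u n)).
  apply: nonincreasing_is_cvgn.
    by apply/nonincreasing_seqP => n; have := ud n; rewrite lecE => /andP[].
  by exists 0 => _ [n _ <-]; have := u0 n; rewrite lecE => /andP[].
apply/cvg_ex; exists (a +i* 0); apply: complex_cvg ua _.
rewrite (_ : (fun n => _) = cst 0); first exact: cvg_cst.
by apply/funext => n; apply: ger0_Im.
Qed.

Lemma series_cvgP w : (forall n, 0 <= w n) ->
  cvgn (series w) <-> exists M, forall N, \sum_(n < N) w n <= M.
Proof.
move=> w0; have sE N : \sum_(n < N) w n = series w N.
  by rewrite /series /= big_mkord.
have smono n m : (n <= m)%N -> series w n <= series w m.
  move=> nm; rewrite /series /= [leRHS](@big_cat_nat _ _ _ n) //=.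
  by rewrite lerDl sumr_ge0.
split=> [/cvg_ex[l wl]|[M wM]].
  exists l => N; rewrite sE; apply: (@cvgn_ge _ (fun n => series w (n + N)%N)).
    by rewrite cvg_shiftn.
  by move=> n; apply: smono; apply: leq_addl.
have : cvgn (fun n => M - series w n).
  apply: nonincreasing_cvg_complex => n; first by rewrite subr_ge0 -sE.
  by rewrite lerD2l lerN2 smono.
move=> /(is_cvgB (is_cvg_cst M)); rewrite (_ : _ - _ = series w) //.
by apply/funext => n /=; rewrite opprB addrCA subrr addr0.
Qed.

End ComplexSequences.

(** * Unconditional products of complex numbers *)

Lemma perm_iota_tail (s : seq nat) m : uniq s -> {subset iota 0 m <= s} ->
  perm_eq s (iota 0 m ++ [seq x <- s | (m <= x)%N]).
Proof.
move=> us ms; apply: uniq_perm => //.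
  rewrite cat_uniq iota_uniq filter_uniq // andbT /=; apply/hasPn => x.
  by rewrite mem_filter mem_iota /= add0n -leqNgt => /andP[].
move=> x; rewrite mem_cat mem_filter mem_iota /= add0n.
have [mx|xm] := leqP m x; first by [].
by rewrite orbF; apply: ms; rewrite mem_iota add0n.
Qed.

Lemma bigop_iota (T : Type) (idx : T) (op : T -> T -> T) (F : nat -> T) N :
  \big[op/idx]_(n < N) F n = \big[op/idx]_(n <- iota 0 N) F n.
Proof. by rewrite -(big_mkord xpredT F) /index_iota subn0. Qed.

Lemma sum_uniq_le (K : numDomainType) (w : nat -> K) (s t : seq nat) :
  (forall n, 0 <= w n) -> uniq s -> uniq t -> {subset s <= t} ->
  \sum_(n <- s) w n <= \sum_(n <- t) w n.
Proof.
move=> w0 us ut st.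
have P : perm_eq s [seq x <- t | x \in s].
  apply: uniq_perm; rewrite ?filter_uniq // => x; rewrite mem_filter.
  by have [/st->|] := boolP (x \in s).
rewrite (perm_big _ P) /= big_filter big_mkcond /=.
by apply: ler_sum => n _; case: ifP.
Qed.

(** The bound 1/2 keeps every partial product below 2 in norm, so that one more
    factor [z n] moves the product by at most [2 * `|1 - z n|]. *)
Lemma prod_dist1_le (K : numFieldType) (z : nat -> K) (s : seq nat) :
  \sum_(n <- s) `|1 - z n| <= 2^-1 ->
  `|1 - \prod_(n <- s) z n| <= 2 * \sum_(n <- s) `|1 - z n|.
Proof.
elim: s => [|x s IH]; first by rewrite !big_nil subrr normr0 mulr0.
rewrite !big_cons; set S := \sum_(n <- s) _; set P := \prod_(n <- s) _ => h.
have hS : S <= 2^-1 by apply: le_trans h; rewrite lerDr.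
have {IH} hP := IH hS; have nP : `|P| <= 2.
  rewrite -[P](subKr 1) (le_trans (ler_normB _ _)) // normr1 -[leRHS]/(1 + 1).
  by rewrite lerD2l (le_trans hP) // -ler_pdivlMl ?mulr1.
have -> : 1 - z x * P = (1 - z x) * P + (1 - P) by ring.
rewrite (le_trans (ler_normD _ _)) // mulrDr lerD // normrM mulrC.
exact: ler_wpM2r.
Qed.

Section ComplexProducts.
Local Open Scope complex_scope.
Variable R : realType.
Local Notation C := (Num.NumField.sort (R[i] : numFieldType)).
Implicit Types (z u : nat -> C).

(** A Cauchy criterion over finite sets that need only be compared with initial
    segments. *)
Lemma net_cauchy_uprod_cvg z :
  (forall e : C, 0 < e -> exists m, forall s : seq nat,
    uniq s -> {subset iota 0 m <= s} ->
    `|\prod_(n < m) z n - \prod_(n <- s) z n| < e) ->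
  exists a, uprod_cvg z a.
Proof.
move=> H; have /cvg_ex[a /cvgn_distP Pa] : cvgn (fun N => \prod_(n < N) z n).
  apply: cauchy_seq_cvg_complex => e /H[m Hm]; exists m => n mn.
  rewrite [X in _ - X]bigop_iota; apply: Hm; first exact: iota_uniq.
  by move=> x; rewrite !mem_iota /= !add0n => /leq_trans; apply.
exists a; apply/uprod_cvgP => e e0.
have e3 : 0 < e / 3 by rewrite divr_gt0.
have [N HN] := Pa _ e3; have [m Hm] := H _ e3; exists m => s us ms.
have NM := HN _ (leq_maxl N m); have mM : `|\prod_(n < m) z n -
    \prod_(n < maxn N m) z n| < e / 3.
  rewrite [X in _ - X]bigop_iota; apply: Hm; first exact: iota_uniq.
  by move=> x; rewrite !mem_iota /= !add0n leq_max => ->; rewrite orbT.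
set M := \prod_(n < maxn N m) z n in NM mM.
set P := \prod_(n < m) z n in mM Hm.
have -> : a - \prod_(n <- s) z n =
  (a - M) + ((M - P) + (P - \prod_(n <- s) z n)) by ring.
have -> : e = e / 3 + (e / 3 + e / 3) by field.
rewrite (le_lt_trans (ler_normD _ _)) // ltrD //.
rewrite (le_lt_trans (ler_normD _ _)) // ltrD //; last exact: Hm.
by rewrite distrC.
Qed.

Lemma summable_tail (w : nat -> C) : (forall n, 0 <= w n) -> cvgn (series w) ->
  forall e, 0 < e -> exists m, forall s : seq nat,
    uniq s -> {in s, forall n, (m <= n)%N} -> \sum_(n <- s) w n < e.
Proof.
move=> w0 /cvg_ex[l wl] e e0; have /cvgn_distP/(_ _ e0)[m Hm] := wl.
have sE N : series w N = \sum_(n <- iota 0 N) w n.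
  by rewrite /series /= /index_iota subn0.
exists m => s us sm; apply: le_lt_trans (Hm m (leqnn _)).
pose M := (m + (\max_(n <- s) n).+1)%N.
have h : \sum_(n <- s) w n <= l - series w m.
  rewrite lerBrDl; apply: (@cvgn_ge _ (fun n => series w (n + M)%N)).
    by rewrite cvg_shiftn.
  move=> n; rewrite !sE -big_cat; apply: sum_uniq_le => //.
  - rewrite cat_uniq iota_uniq us andbT /=; apply/hasPn => x /sm.
    by rewrite mem_iota /= add0n -leqNgt.
  - exact: iota_uniq.
  move=> x; rewrite mem_cat !mem_iota /= !add0n => /orP[xm|xs].
    by rewrite /M (leq_trans xm) // addnCA leq_addr.
  rewrite /M addnA addnS ltnS (@leq_trans (\max_(n <- s) n)) ?leq_addl //.
  exact: leq_bigmax_seq.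
have l0 : 0 <= l - series w m by apply: le_trans h; apply: sumr_ge0.
by rewrite (le_trans h) // ger0_norm.
Qed.

(** An absolutely convergent product converges unconditionally: the factors
    beyond a large index change a finite product only slightly. *)
Lemma abs_uprod_cvg z : cvgn (series (fun n => `|1 - z n|)) ->
  exists a, uprod_cvg z a.
Proof.
move=> /(summable_tail (fun n => normr_ge0 _)) H.
have {}H e : 0 < e -> exists m, forall s : seq nat, uniq s ->
    {in s, forall n, (m <= n)%N} -> `|1 - \prod_(n <- s) z n| < e.
  move=> e0; have h0 : 0 < Num.min (e / 2) 2^-1 :> C.
    by rewrite /Num.min; case: ifP => _; rewrite ?divr_gt0 // invr_gt0.
  have [m Hm] := H _ h0.
  have min2 : Num.min (e / 2) 2^-1 <= e / 2 /\ Num.min (e / 2) 2^-1 <= 2^-1 :> C.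
    rewrite /Num.min; case: ifP => [/ltW->//|/negbT]; rewrite -real_leNgt //.
      by rewrite gtr0_real ?invr_gt0.
    by rewrite gtr0_real ?divr_gt0.
  exists m => s us /(Hm s us) hs; apply: le_lt_trans (prod_dist1_le _) _.
    exact: le_trans (ltW hs) min2.2.
  by rewrite -ltr_pdivlMl // mulrC; apply: lt_le_trans hs min2.1.
have [m1 Hm1] := H 1 ltr01; pose B := 2 * `|\prod_(n < m1) z n|.
have PB m : (m1 <= m)%N -> `|\prod_(n < m) z n| <= B.
  move=> m1m; rewrite bigop_iota -(subnKC m1m) iotaD big_cat /= add0n.
  rewrite -bigop_iota normrM /B mulrC ler_wpM2r //.
  rewrite -[X in `|X|](subKr 1) (le_trans (ler_normB _ _)) // normr1.
  rewrite -[leRHS]/(1 + 1) lerD2l ltW // Hm1 ?iota_uniq // => n.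
  by rewrite mem_iota => /andP[].
apply: net_cauchy_uprod_cvg => e e0.
have B0 : 0 < B + 1 by rewrite ltr_wpDl ?ltr01 // mulr_ge0.
have [m2 Hm2] := H _ (divr_gt0 e0 B0).
exists (maxn m1 m2) => s us ms.
rewrite (perm_big _ (perm_iota_tail us ms)) big_cat /= -bigop_iota.
rewrite -{1}[X in X - _]mulr1 -mulrBr normrM.
have h1 := PB _ (leq_maxl m1 m2); have h2 : `|1 -
    \prod_(n <- [seq x <- s | (maxn m1 m2 <= x)%N]) z n| < e / (B + 1).
  apply: Hm2; first exact: filter_uniq.
  by move=> x; rewrite mem_filter geq_max => /andP[/andP[]].
apply: le_lt_trans (ler_wpM2r (normr_ge0 _) h1) _.
apply: (@le_lt_trans _ _ (B * (e / (B + 1)))).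
  by rewrite ler_wpM2l ?mulr_ge0 // ltW.
rewrite mulrA ltr_pdivrMr // mulrC ltr_pM2l // ltrDl; exact: ltr01.
Qed.

(** Products of numbers in the unit interval decrease as the set grows, and
    initial segments are cofinal: the limit along them is the infimum over all
    finite sets. *)
Lemma uprod_cvg_le1 u : (forall n, 0 <= u n <= 1) -> exists a, uprod_cvg u a.
Proof.
move=> u01; have u0 n : 0 <= u n by case/andP: (u01 n).
have u1 n : u n <= 1 by case/andP: (u01 n).
have pS N : \prod_(n < N.+1) u n <= \prod_(n < N) u n.
  by rewrite big_ord_recr /= ler_piMr // prodr_ge0.
have /cvg_ex[a Pa] : cvgn (fun N => \prod_(n < N) u n).
  by apply: nonincreasing_cvg_complex => n //; apply: prodr_ge0.
apply: net_cauchy_uprod_cvg => e e0; have /cvgn_distP/(_ _ e0)[m Hm] := Pa.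
exists m => s us ms; apply: le_lt_trans (Hm m (leqnn _)).
have pmono N M : (N <= M)%N -> \prod_(n < M) u n <= \prod_(n < N) u n.
  move=> /subnKC<-; elim: (M - N)%N => [|k IH]; first by rewrite addn0.
  by rewrite addnS (le_trans (pS _)).
have t1 (t : seq nat) : \prod_(n <- t) u n <= 1.
  elim: t => [|x t IH]; first by rewrite big_nil.
  by rewrite big_cons mulr_ile1 // prodr_ge0.
have sm : \prod_(n <- s) u n <= \prod_(n < m) u n.
  rewrite (perm_big _ (perm_iota_tail us ms)) big_cat /= -bigop_iota.
  by rewrite ler_piMr // prodr_ge0.
have as_ : a <= \prod_(n <- s) u n.
  pose M := (\max_(n <- s) n).+1.
  apply: (@le_trans _ _ (\prod_(n < M) u n)).
    apply: (@cvgn_le _ (fun n => \prod_(k < n + M) u k)).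
      by rewrite (cvg_shiftn M (fun N => \prod_(k < N) u k)).
    by move=> n; apply: pmono; rewrite leq_addl.
  have P : perm_eq (iota 0 M) (s ++ [seq x <- iota 0 M | x \notin s]).
    apply: uniq_perm; rewrite ?iota_uniq //.
      rewrite cat_uniq us filter_uniq ?iota_uniq // andbT.
      by apply/hasPn => x; rewrite mem_filter => /andP[].
    move=> x; rewrite mem_cat mem_filter mem_iota leq0n add0n.
    have [xs /=|//] := boolP (x \in s).
    by rewrite /M ltnS; apply: leq_bigmax_seq.
  by rewrite bigop_iota (perm_big _ P) big_cat /= ler_piMr // prodr_ge0.
rewrite ger0_norm ?subr_ge0 // distrC ger0_norm ?subr_ge0 ?(le_trans as_) //.
by rewrite lerD2l lerN2.
Qed.

End ComplexProducts.

Section Converse.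
Local Open Scope complex_scope.
Variable R : realType.
Local Notation C := (Num.NumField.sort (R[i] : numFieldType)).
Import ComplexField.Normc.

Lemma ReD (x y : R[i]) : complex.Re (x + y) = complex.Re x + complex.Re y.
Proof. by case: x y => ? ? [? ?]. Qed.

Lemma Re_le_normc (x : R[i]) : `|complex.Re x| <= normc x.
Proof. by rewrite -lecR; apply: normc_ge_Re. Qed.

(** If all the [z n - 1] point roughly in the direction of [d^-1], they cannot
    cancel: each factor moves the product, which stays near 1, in that
    direction. *)
Lemma sector_sum_le (d : R[i]) (z : nat -> R[i]) (t : seq nat) :
  normc d = 1 ->
  (forall t' : seq nat, subseq t' t -> normc (\prod_(n <- t') z n - 1) <= 4^-1) ->
  (forall n, n \in t -> normc (z n - 1) <= 2 * complex.Re (d * (z n - 1))) ->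
  \sum_(n <- t) normc (z n - 1) <= 4 * complex.Re (d * (\prod_(n <- t) z n - 1)).
Proof.
move=> d1; elim: t => [|x t IH] Ht Hd.
  by rewrite !big_nil subrr mulr0 mulr0.
rewrite !big_cons; set P := \prod_(n <- t) z n.
have {IH} hP := IH (fun t' s => Ht t' (subseq_trans s (subseq_cons t x)))
  (fun n nt => Hd n (mem_behead (nt : n \in behead (x :: t)))).
have -> : d * (z x * P - 1) =
    d * (P - 1) + (d * (z x - 1) + d * (z x - 1) * (P - 1)) by ring.
have hx := Hd x (mem_head x t); have hPt := Ht t (subseq_cons t x).
have := Re_le_normc (d * (z x - 1) * (P - 1)).
rewrite !ReD !normcM d1 mul1r ler_norml => /andP[h _].
have : normc (z x - 1) * normc (P - 1) <= normc (z x - 1) * 4^-1.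
  by rewrite ler_wpM2l // -ler0c; apply: (normr_ge0 (z x - 1)).
rewrite /= in hP *; lra.
Qed.

(** The converse of [abs_uprod_cvg]: unconditional convergence to a nonzero
    value keeps all finite products of distant factors close to 1, and
    [sector_sum_le] applies to the factors in each of the four directions. *)
Lemma uprod_cvg_abs (z : nat -> C) a : uprod_cvg z a -> a != 0 ->
  cvgn (series (fun n => `|1 - z n|)).
Proof.
move=> /uprod_cvgP za a0; have na0 : 0 < `|a| by rewrite normr_gt0.
have [m Hm] := za _ (divr_gt0 na0 (ltr0Sn _ 8)).
set e := `|a| / 9 in Hm; pose P := \prod_(n <- iota 0 m) z n.
have tail (t : seq nat) : uniq t -> {in t, forall n, (m <= n)%N} ->
    normc (\prod_(n <- t) z n - 1) <= 4^-1.
  move=> ut tm.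
  have h1 : `|a - P| < e by apply: Hm => //; apply: iota_uniq.
  have h2 : `|a - P * \prod_(n <- t) z n| < e.
    rewrite -big_cat; apply: Hm.
      rewrite cat_uniq iota_uniq ut andbT /=; apply/hasPn => x /tm.
      by rewrite mem_iota /= add0n -leqNgt.
    by move=> x; rewrite mem_cat => ->.
  (* [P] is within [e] of [a], whose norm is [9 * e]. *)
  have P8 : 8 * e <= `|P|.
    rewrite (_ : 8 * e = `|a| - e) ?lerBlDl; last by rewrite /e; field.
    rewrite -{1}[a](subrK P) (le_trans (ler_normD _ _)) // lerD2r.
    exact: ltW.
  have e0 : 0 < e by rewrite divr_gt0.
  have : `|P| * `|\prod_(n <- t) z n - 1| <= 2 * e.
    rewrite -normrM (_ : P * _ = (a - P) - (a - P * \prod_(n <- t) z n)).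
      rewrite (le_trans (ler_normB _ _)) // (_ : 2 * e = e + e); last by ring.
      by rewrite lerD // ltW.
    by ring.
  move=> /(le_trans (ler_wpM2r (normr_ge0 _) P8)).
  rewrite (_ : 2 * e = 8 * e * 4^-1); last by field.
  have e8 : 0 < 8 * e by apply: mulr_gt0.
  rewrite (ler_pM2l e8) => h.
  by rewrite -(lecR (normc _) 4^-1) fmorphV rmorph_nat.
have sector d (t : seq nat) : normc d = 1 -> uniq t ->
    {in t, forall n, (m <= n)%N} ->
    \sum_(n <- t | normc (z n - 1) <= 2 * complex.Re (d * (z n - 1)))
      normc (z n - 1) <= 1.
  move=> d1 ut tm; rewrite -big_filter.
  set t' := [seq n <- t | _].
  have tt x : x \in t' -> x \in t by rewrite mem_filter => /andP[].
  have H := @sector_sum_le d z t' d1.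
  apply: le_trans (H _ _) _.
  - move=> s st; apply: tail; first by apply: subseq_uniq st _; apply: filter_uniq.
    by move=> n /(mem_subseq st)/tt/tm.
  - by move=> n; rewrite mem_filter => /andP[].
  have := Re_le_normc (d * (\prod_(n <- t') z n - 1)).
  rewrite normcM d1 mul1r ler_norml => /andP[_ h].
  have : normc (\prod_(n <- t') z n - 1) <= 4^-1.
    by apply: tail => [|n /tt/tm //]; apply: filter_uniq.
  rewrite /= in h *; lra.
have bound (t : seq nat) : uniq t -> {in t, forall n, (m <= n)%N} ->
    \sum_(n <- t) normc (z n - 1) <= 4.
  move=> ut tm; pose S d := \sum_(n <- t |
    normc (z n - 1) <= 2 * complex.Re (d * (z n - 1))) normc (z n - 1).
  have h1 : S 1 <= 1 by apply: sector; rewrite ?normc1.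
  have h2 : S (-1) <= 1 by apply: sector; rewrite ?normcN ?normc1.
  have ni : normc ('i%C : R[i]) = 1 by rewrite /= expr0n expr1n add0r sqrtr1.
  have h3 : S ('i%C) <= 1 by apply: sector.
  have h4 : S (- 'i%C) <= 1 by apply: sector; rewrite ?normcN.
  (* Of the real and imaginary parts of [z n - 1], one has at least half of the
     modulus, so every [n] is counted in one of the four sums. *)
  suff : \sum_(n <- t) normc (z n - 1) <= (S 1 + S (-1)) + (S 'i%C + S (- 'i%C)).
    by lra.
  have SE d : S d = \sum_(n <- t)
      if normc (z n - 1) <= 2 * complex.Re (d * (z n - 1))
      then normc (z n - 1) else 0 by apply: big_mkcond.
  rewrite !SE -!big_split; apply: ler_sum => n _ /=.
  have f0 : 0 <= normc (z n - 1) by rewrite -ler0c; apply: (normr_ge0 (z n - 1)).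
  have := normc_le_ReIm (z n - 1); rewrite lecR -/(normc _).
  have -> : complex.Re ('i%C * (z n - 1)) = - complex.Im (z n - 1).
    by rewrite mulrC ReiNIm.
  have -> : complex.Re (- 'i%C * (z n - 1)) = complex.Im (z n - 1).
    by rewrite mulNr -mulrN mulrC ReiNIm; case: (z n - 1) => ? ? /=; rewrite opprK.
  rewrite mul1r mulN1r [complex.Re (- _)](_ : _ = - complex.Re (z n - 1)); last first.
    by case: (z n - 1).
  move: (normc _) (complex.Re _) (complex.Im _) f0 => f x y f0 fxy.
  have fx : `|x| <= x \/ `|x| <= - x.
    by have [] := ger0P x; [left|right].
  have fy : `|y| <= y \/ `|y| <= - y.
    by have [] := ger0P y; [left|right].
  do 4! case: ifPn; rewrite -?ltNge; lra.
apply/series_cvgP => [n|]; first exact: normr_ge0.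
exists (\sum_(n <- iota 0 m) `|1 - z n| + 4) => N.
apply: (@le_trans _ _ (\sum_(n <- iota 0 (m + N)) `|1 - z n|)).
  rewrite (bigop_iota _ _ (fun n => `|1 - z n|)).
  apply: sum_uniq_le; rewrite ?iota_uniq // => n.
  by rewrite !mem_iota /= !add0n => /leq_trans; apply; rewrite leq_addl.
rewrite iotaD big_cat /= lerD2l.
rewrite (_ : \sum_(_ <- _) _ = (\sum_(n <- iota (0 + m) N) normc (z n - 1))%:C).
  rewrite -(rmorph_nat (real_complex R)) lecR bound ?iota_uniq // => n.
  by rewrite mem_iota add0n => /andP[].
rewrite rmorph_sum; apply: eq_bigr => n _; exact: distrC.
Qed.

End Converse.

(** * Inner products *)

(** The form may be degenerate: the values of the quadratic form on the plane
    spanned by the two vectors are all that the proof looks at. *)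
Lemma cauchy_schwarz_scalar (K : numClosedFieldType) (a b c : K) :
  (forall s t : K, 0 <= s * s^* * a + s * t^* * c + (s * t^* * c)^* + t * t^* * b) ->
  `|c| ^+ 2 <= a * b.
Proof.
move=> H.
have a0 : 0 <= a.
  by have := H 1 0; rewrite !(conjC1, conjC0, mul0r, mulr0, mul1r, mulr1, addr0).
have b0 : 0 <= b.
  have := H 0 1.
  by rewrite !(conjC1, conjC0, mul0r, mulr0, mul1r, mulr1, addr0, add0r).
rewrite normCK -subr_ge0; have [b00|bN0] := eqVneq b 0; last first.
  have bp : 0 < b by rewrite lt0r bN0.
  have := H b (- c); rewrite !(rmorphM, rmorphN) /= !conjCK !(geC0_conj b0).
  rewrite (_ : _ + _ = b * (a * b - c * c^*)); last by ring.
  by rewrite pmulr_rge0.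
have [a00|aN0] := eqVneq a 0; last first.
  have ap : 0 < a by rewrite lt0r aN0.
  have := H (- c^*) a; rewrite !(rmorphM, rmorphN) /= !conjCK !(geC0_conj a0).
  rewrite (_ : _ + _ = a * (a * b - c * c^*)); last by ring.
  by rewrite pmulr_rge0.
have := H 1 (- c); rewrite !(rmorphM, rmorphN) /= conjCK rmorph1.
rewrite a00 b00 (_ : _ + _ = 2 * (0 * 0 - c * c^*)); last by ring.
by rewrite pmulr_rge0.
Qed.

Lemma cauchy_schwarz_form (K : numClosedFieldType) (V : lmodType K)
    (F : V -> V -> K) (x y : V) :
  (forall a u v w, F (a *: u + v) w = a * F u w + F v w) ->
  (forall u v, F u v = (F v u)^*) -> (forall u, 0 <= F u u) ->
  `|F x y| ^+ 2 <= F x x * F y y.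
Proof.
move=> Fl FC F0; have Fr u a v w : F u (a *: v + w) = a^* * F u v + F u w.
  by rewrite FC Fl rmorphD rmorphM /= -!FC.
have F0l u : F 0 u = 0.
  by apply: (addrI (F 0 u)); rewrite -{1}[F 0 u]mul1r -Fl scaler0 !addr0.
have F0r u : F u 0 = 0 by rewrite FC F0l conjC0.
apply: cauchy_schwarz_scalar => s t.
have -> : (s * t^* * F x y)^* = t * s^* * F y x.
  by rewrite !rmorphM /= conjCK -FC [s^* * _]mulrC.
rewrite (_ : _ + _ = F (s *: x + (t *: y + 0)) (s *: x + (t *: y + 0))) ?F0 //.
by rewrite !(Fl, Fr) !(F0l, F0r); ring.
Qed.

Lemma norm_scale (K : numClosedFieldType) (a r d r' d' : K) : 0 <= r -> 0 <= r' ->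
  r ^+ 2 = d -> r' ^+ 2 = d' -> d' = a * (a^* * d) -> r' = `|a| * r.
Proof.
move=> r0 r'0 rd r'd' dd'; apply/eqP.
by rewrite -(@eqrXn2 _ 2) ?mulr_ge0 // exprMn r'd' rd dd' mulrA -normCK.
Qed.

Lemma norm_le_mul (K : numClosedFieldType) (r s a b c : K) : 0 <= r -> 0 <= s ->
  r ^+ 2 = a -> s ^+ 2 = b -> `|c| ^+ 2 <= a * b -> `|c| <= r * s.
Proof.
move=> r0 s0 <- <-; rewrite -exprMn ler_pXn2r ?nnegrE //; exact: mulr_ge0.
Qed.

Section Hilbert.
Variables (K : numClosedFieldType) (V : hilbertType K).
Implicit Types (x y z : V) (a : K).

Lemma hdotC x y : <[x, y]> = <[y, x]>^*.
Proof. by rewrite hermC expr0 mul1r. Qed.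

Lemma hdotDl x y z : <[x + y, z]> = <[x, z]> + <[y, z]>.
Proof. exact: linearDl. Qed.

Lemma hdotBl x y z : <[x - y, z]> = <[x, z]> - <[y, z]>.
Proof. exact: linearBl. Qed.

Lemma hdotZl a x z : <[a *: x, z]> = a * <[x, z]>.
Proof. exact: linearZl_LR. Qed.

Lemma hdot0l z : <[0, z]> = 0 :> K.
Proof. exact: linear0l. Qed.

Lemma hdotDr x y z : <[x, y + z]> = <[x, y]> + <[x, z]>.
Proof. exact: linearDr. Qed.

Lemma hdotBr x y z : <[x, y - z]> = <[x, y]> - <[x, z]>.
Proof. exact: linearBr. Qed.

Lemma hdotZr a x z : <[x, a *: z]> = a^* * <[x, z]>.
Proof. by rewrite hdotC hdotZl rmorphM /= -hdotC. Qed.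

Lemma hdot0r x : <[x, 0]> = 0 :> K.
Proof. by rewrite hdotC hdot0l conjC0. Qed.

Lemma hdot_ge0 x : 0 <= <[x, x]> :> K.
Proof. by rewrite -hdot_normE exprn_ge0. Qed.

Lemma hdot_cauchy_schwarz x y : `|<[x, y]> : K| <= `|x| * `|y|.
Proof.
apply: (norm_le_mul (normr_ge0 x) (normr_ge0 y) (hdot_normE x) (hdot_normE y)).
apply: cauchy_schwarz_form => [a u v w|u v|u].
- by rewrite hdotDl hdotZl.
- exact: hdotC.
exact: hdot_ge0.
Qed.

Lemma hdot_cvg (u : nat -> V) x y : u @ \oo --> x ->
  (fun n => <[u n, y]> : K) @ \oo --> <[x, y]>.
Proof.
move=> /cvgn_distP ux; apply/cvgn_distP => e e0.
have y1 : 0 < `|y| + 1 by rewrite ltr_wpDl.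
have [N HN] := ux _ (divr_gt0 e0 y1); exists N => n /HN.
rewrite ltr_pdivlMr //; apply: le_lt_trans.
rewrite -hdotBl (le_trans (hdot_cauchy_schwarz _ _)) //.
by rewrite ler_wpM2l // lerDl.
Qed.

End Hilbert.

(** * Linear spans and projections *)

Section LinearSpan.
Variables (K : numFieldType).

Lemma linear_span_ind (V : lmodType K) (A : set V) (P : V -> Prop) : P 0 ->
  (forall a x y, A x -> P y -> P (a *: x + y)) -> forall v, linear_span A v -> P v.
Proof.
move=> P0 PS _ [n [c [a [aA ->]]]]; elim: n c a aA => [|n IH] c a aA.
  by rewrite big_ord0.
by rewrite big_ord_recl; apply: PS => //; apply: IH => i; apply: aA.
Qed.

Lemma linear_span0 (V : lmodType K) (A : set V) : linear_span A 0.
Proof.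
by exists 0%N, (fun=> 0), (fun=> 0); split; [case|rewrite big_ord0].
Qed.

Lemma linear_spanS (V : lmodType K) (A : set V) a x y :
  A x -> linear_span A y -> linear_span A (a *: x + y).
Proof.
move=> Ax [n [c [b [bA ->]]]].
exists n.+1, (fun i => if unlift ord0 i is Some j then c j else a),
  (fun i => if unlift ord0 i is Some j then b j else x); split.
  by move=> i; case: unliftP.
rewrite big_ord_recl unlift_none; congr (_ + _).
by apply: eq_bigr => i _; rewrite liftK.
Qed.

Lemma closure_distP (V : normedModType K) (A : set V) x :
  closure A x <-> forall e : K, 0 < e -> exists2 v, A v & `|x - v| < e.
Proof.
split=> [xA e e0|H B /nbhs_ballP[e /= e0 eB]].
  have [|v [Av]] := xA (ball x e); first exact: nbhsx_ballx.
  by rewrite -ball_normE; exists v.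
by have [v Av xv] := H e e0; exists v; split=> //; apply: eB; rewrite -ball_normE.
Qed.

Lemma dense_dist (V : normedModType K) (A : set V) : dense A ->
  forall x (e : K), 0 < e -> exists2 v, A v & `|x - v| < e.
Proof.
move=> dA x e e0; have [|v []] := dA (ball x e) _ (ball_open x e).
  by exists x; apply: ballxx.
by rewrite -ball_normE => xv Av; exists v.
Qed.

End LinearSpan.

Section Projection.
Variables (K : numClosedFieldType) (V : hilbertType K) (J : Type) (d p : J -> V).
Hypothesis invS_lt : forall e : K, 0 < e ->
  exists N, forall n, (N <= n)%N -> n.+1%:R^-1 < e.
Hypothesis dense_d : forall x e, 0 < e ->
  exists2 v, linear_span (range d) v & `|x - v| < e.
Hypothesis dp : forall i j, <[d i, p j]> = <[p i, p j]>.

(** [z] is the orthogonal projection of [x] to the closed span of the [p j],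
    which is described as the set of vectors orthogonal to every vector that is
    orthogonal to all [p j]. *)
Let proj x z := (forall j, <[x - z, p j]> = 0) /\
  (forall v, (forall j, <[v, p j]> = 0) -> <[v, z]> = 0).

Let projD a x z x' z' : proj x z -> proj x' z' -> proj (a *: x + x') (a *: z + z').
Proof.
move=> [xz zW] [xz' zW']; split=> [j|v vp].
  by rewrite opprD addrACA -scalerBr hdotDl hdotZl xz xz' mulr0 addr0.
by rewrite hdotDr hdotZr zW // zW' // mulr0 addr0.
Qed.

Let proj_le x z : proj x z -> `|z| <= `|x|.
Proof.
move=> [xz zW]; have [->|z0] := eqVneq z 0; first by rewrite normr0.
have zp : 0 < `|z| by rewrite normr_gt0.
rewrite -(ler_pM2r zp) -expr2 hdot_normE.
have E : <[z, z]> = <[x, z]>.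
  by apply/esym/eqP; rewrite -subr_eq0 -hdotBl zW.
rewrite E.
by rewrite -[leLHS]ger0_norm ?hdot_cauchy_schwarz // -E hdot_ge0.
Qed.

Let proj_dist x z x' z' : proj x z -> proj x' z' -> `|z - z'| <= `|x - x'|.
Proof.
move=> xz xz'; have := projD (-1) xz' xz.
by rewrite !scaleN1r ![- _ + _]addrC => /proj_le.
Qed.

(* Vectors of the span have projections by linearity; as projecting does not
   increase distances, projections of approximations of [x] converge. *)
Let proj_exists x : exists z, proj x z.
Proof.
have small (e : K) : 0 < e -> exists y z, proj y z /\ `|x - y| < e.
  move=> e0; have [v vd xv] := dense_d x e0; exists v.
  suff [z vz] : exists z, proj v z by exists z.
  move: v vd {xv}; apply: linear_span_ind => [|a _ v [j _ <-] [z vz]].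
    by exists 0; split=> [j|u _]; rewrite ?subr0 ?hdot0l ?hdot0r.
  exists (a *: p j + z); apply: projD vz; split=> [i|u]; last exact.
  by rewrite hdotBl dp subrr.
have /choice[y Hy] : forall n, exists y, exists z, proj y z /\ `|x - y| < n.+1%:R^-1.
  by move=> n; apply: small; rewrite invr_gt0 ltr0Sn.
have /choice[z Hz] := Hy.
have yx : y @ \oo --> x.
  apply/cvgn_distP => e /invS_lt[N HN]; exists N => n /HN.
  by apply: lt_trans; case: (Hz n).
have /cvg_ex[l zl] : cvgn z.
  apply: cauchy_seq_cvg => e e0; have e2 : 0 < e / 2 by rewrite divr_gt0.
  have [N HN] := invS_lt e2; exists N => n /HN hn.
  have [pN yN] := Hz N; have [pn yn] := Hz n.
  rewrite (le_lt_trans (proj_dist pN pn)) // -(subrK x (y N)) -addrA.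
  rewrite (le_lt_trans (ler_normD _ _)) // [ltRHS]splitr ltrD //.
    by rewrite distrC (lt_trans yN) // HN.
  exact: lt_trans yn hn.
exists l; split=> [j|v vp].
  have yzl : (fun n => y n - z n) @ \oo --> x - l by apply: cvgB.
  apply: (cvgn_unique (@hdot_cvg _ _ _ _ (p j) yzl)).
  rewrite (_ : (fun n => _) = cst 0); first exact: cvg_cst.
  by apply/funext => n /=; case: (Hz n) => -[].
rewrite hdotC -[RHS]conjC0; congr (_^*).
apply: (cvgn_unique (@hdot_cvg _ _ _ _ v zl)).
rewrite (_ : (fun n => _) = cst 0); first exact: cvg_cst.
apply/funext => n /=; case: (Hz n) => -[_ zW] _.
by rewrite hdotC zW ?conjC0.
Qed.

(** An assignment [d j |-> p j] on a total family extends to a contraction once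
    it has the inner products of an orthogonal projection; linearity and
    boundedness on the span come for free. *)
Lemma projection_operator : exists P : V -> V,
  [/\ bounded_operator [set: V] P, forall x, `|P x| <= `|x|
    & forall j, P (d j) = p j].
Proof.
have /choice[P PP] := proj_exists; exists P.
have uniq x z : proj x z -> P x = z.
  move=> xz; apply/eqP; rewrite -subr_eq0 -normr_eq0 eq_le normr_ge0 andbT.
  by rewrite (le_trans (proj_dist (PP x) xz)) // subrr normr0.
split.
- split=> // [a x y _ _|]; first by apply: uniq; apply: projD.
  by exists 1 => x _; rewrite mul1r; apply: proj_le.
- by move=> x; apply: proj_le.
move=> j; apply: uniq; split=> [i|u]; last exact.
by rewrite hdotBl dp subrr.
Qed.

End Projection.

(** * Positive kernels and their Hilbert spaces *)

Section Small.
Variable K : numFieldType.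

Lemma eq0_small (x c : K) : (forall e, 0 < e -> `|x| <= c * e) -> x = 0.
Proof.
move=> H; apply/eqP; rewrite -normr_eq0 eq_le normr_ge0 andbT.
apply/ler_addgt0Pl => e e0; rewrite addr0.
have c0 : 0 <= c by have := H 1 ltr01; rewrite mulr1; apply: le_trans.
have c1 : 0 < c + 1 by rewrite ltr_wpDl.
rewrite (le_trans (H _ (divr_gt0 e0 c1))) // mulrA ler_pdivrMr // mulrC.
by rewrite ler_pM2l // lerDl ler01.
Qed.

Lemma ge0_approx (x c : K) :
  (forall e, 0 < e -> exists2 r, 0 <= r & `|x - r| <= c * e) -> 0 <= x.
Proof.
move=> H; suff -> : x = `|x| by [].
apply/eqP; rewrite -subr_eq0; apply/eqP/(@eq0_small _ (c * 2)) => e /H[r r0 xr].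
rewrite -[x in x - _](subrK r) -addrA (le_trans (ler_normD _ _)) //.
rewrite -mulrA mulrDl mul1r mulrDr lerD // -(ger0_norm r0).
by apply: le_trans (ler_dist_dist _ _) _; rewrite distrC.
Qed.

End Small.

Section Kernels.
Variables (K : numClosedFieldType) (X : Type).
Implicit Types (l : seq (K * X)) (a : K).

(** A list of weighted points stands for the formal combination of the functions
    [k x]; this is the inner product that two combinations will have. *)
Definition kform (k : X -> X -> K) l l' : K :=
  \sum_(p <- l) \sum_(q <- l') p.1 * q.1^* * k p.2 q.2.

Definition psd (k : X -> X -> K) :=
  (forall x y, k x y = (k y x)^*) /\ forall l, 0 <= kform k l l.

Record psd_kernel := PsdKernel {
  kernel :> X -> X -> K ;
  kernel_psd : psd kernel }.

Lemma kernelC (k : psd_kernel) x y : k x y = (k y x)^*.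
Proof. exact: (kernel_psd k).1. Qed.

Lemma kform_ge0 (k : psd_kernel) l : 0 <= kform k l l.
Proof. exact: (kernel_psd k).2. Qed.

Definition kscale a l := [seq (a * p.1, p.2) | p <- l].

(** The inner product of [g] with the combination [l], by the reproducing
    property. *)
Definition kpairing (g : X -> K^o) l : K := \sum_(q <- l) q.1^* * g q.2.

Lemma kpairing_cat g l l' : kpairing g (l ++ l') = kpairing g l + kpairing g l'.
Proof. exact: big_cat. Qed.

Lemma kpairing_scale g a l : kpairing g (kscale a l) = a^* * kpairing g l.
Proof.
rewrite /kpairing big_map mulr_sumr; apply: eq_bigr => p _ /=.
by rewrite rmorphM mulrA.
Qed.

Lemma kpairingD g g' l : kpairing (g + g') l = kpairing g l + kpairing g' l.
Proof. by rewrite /kpairing -big_split; apply: eq_bigr => p _; apply: mulrDr. Qed.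

Lemma kpairingZ a g l : kpairing (a *: g) l = a * kpairing g l.
Proof. by rewrite /kpairing mulr_sumr; apply: eq_bigr => p _; apply: mulrCA. Qed.

Lemma kpairingB g g' l : kpairing (g - g') l = kpairing g l - kpairing g' l.
Proof. by rewrite -scaleN1r kpairingD kpairingZ mulN1r. Qed.

Variable k : psd_kernel.
Implicit Types g : X -> K^o.

Definition kcomb l : X -> K^o := fun x => \sum_(p <- l) p.1 * k p.2 x.

Lemma kcomb_cat l l' : kcomb (l ++ l') = kcomb l + kcomb l'.
Proof. by apply/funext => x; apply: big_cat. Qed.

Lemma kcomb_scale a l : kcomb (kscale a l) = a *: kcomb l.
Proof.
apply/funext => x; rewrite -[RHS]/(a * \sum_(p <- l) p.1 * k p.2 x).
by rewrite /kcomb big_map mulr_sumr; apply: eq_bigr => p _; rewrite mulrA.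
Qed.

Lemma kpairing_kcomb l l' : kpairing (kcomb l) l' = kform k l l'.
Proof.
rewrite /kform exchange_big; apply: eq_bigr => q _ /=.
by rewrite mulr_sumr; apply: eq_bigr => p _; rewrite mulrCA mulrA.
Qed.

Lemma kformC l l' : kform k l l' = (kform k l' l)^*.
Proof.
rewrite /kform exchange_big rmorph_sum; apply: eq_bigr => q _ /=.
rewrite rmorph_sum; apply: eq_bigr => p _ /=.
by rewrite !rmorphM /= conjCK -kernelC [q.1^* * _]mulrC.
Qed.

Definition seminorm l := sqrtC (kform k l l).

Lemma seminorm_ge0 l : 0 <= seminorm l.
Proof. by rewrite sqrtC_ge0 kform_ge0. Qed.

Lemma kform_cauchy_schwarz l l' : `|kform k l l'| <= seminorm l * seminorm l'.
Proof.
apply: norm_le_mul (sqrtCK _) (sqrtCK _) _; rewrite ?seminorm_ge0 //.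
apply: cauchy_schwarz_scalar => s t.
have := kform_ge0 k (kscale s l ++ kscale t l').
rewrite -kpairing_kcomb kcomb_cat !kcomb_scale kpairingD !kpairingZ.
rewrite !kpairing_cat !kpairing_scale.
rewrite !kpairing_kcomb (kformC l' l) => /le_trans; apply.
by rewrite le_eqVlt; apply/orP; left; apply/eqP; rewrite !rmorphM /= conjCK; ring.
Qed.

(** The functional that [g] defines on the combinations of kernel functions has
    norm at most [e]. *)
Definition bounded_by g (e : K) := forall l, `|kpairing g l| <= e * seminorm l.

Lemma bounded_kcomb l : bounded_by (kcomb l) (seminorm l).
Proof. by move=> l'; rewrite kpairing_kcomb kform_cauchy_schwarz. Qed.

Lemma bounded_byD g g' e e' : bounded_by g e -> bounded_by g' e' ->
  bounded_by (g + g') (e + e').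
Proof.
move=> ge ge' l; rewrite kpairingD mulrDl (le_trans (ler_normD _ _)) //.
by rewrite lerD ?ge ?ge'.
Qed.

Lemma bounded_byZ a g e : bounded_by g e -> bounded_by (a *: g) (`|a| * e).
Proof. by move=> ge l; rewrite kpairingZ normrM -mulrA ler_wpM2l ?ge. Qed.

Lemma bounded_byN g e : bounded_by g e -> bounded_by (- g) e.
Proof. by move=> /(bounded_byZ (-1)); rewrite scaleN1r normrN1 mul1r. Qed.

Lemma bounded_byB g g' e e' : bounded_by g e -> bounded_by g' e' ->
  bounded_by (g - g') (e + e').
Proof. by move=> ge /bounded_byN; apply: bounded_byD. Qed.

Lemma bounded_by_le g e e' : e <= e' -> bounded_by g e -> bounded_by g e'.
Proof. by move=> ee' ge l; rewrite (le_trans (ge l)) // ler_wpM2r ?seminorm_ge0. Qed.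

Lemma seminorm_le l e : 0 <= e -> bounded_by (kcomb l) e -> seminorm l <= e.
Proof.
move=> e0 /(_ l); rewrite kpairing_kcomb ger0_norm ?kform_ge0 //.
rewrite -[kform _ _ _]sqrtCK -/(seminorm l) expr2.
have [->//|l0] := eqVneq (seminorm l) 0.
by rewrite ler_pM2r // lt0r l0 seminorm_ge0.
Qed.

(** The Hilbert space of the kernel is the closure of the combinations for the
    norm of functionals. *)
Definition rkhs_set : set (X -> K^o) :=
  [set g | forall e, 0 < e -> exists l, bounded_by (g - kcomb l) e].

Lemma kcomb_rkhs l : rkhs_set (kcomb l).
Proof.
move=> e e0; exists l => l'; rewrite kpairingB subrr normr0.
by rewrite mulr_ge0 ?seminorm_ge0 // ltW.
Qed.

Lemma rkhs_setP a g g' : rkhs_set g -> rkhs_set g' -> rkhs_set (a *: g + g').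
Proof.
move=> gH g'H e e0; have a1 : 0 < `|a| + 1 by rewrite ltr_wpDl.
have e2 : 0 < e / 2 by rewrite divr_gt0.
have [l gl] := gH _ (divr_gt0 e2 a1); have [l' gl'] := g'H _ e2.
exists (kscale a l ++ l'); rewrite kcomb_cat kcomb_scale opprD addrACA -scalerBr.
apply: bounded_by_le (bounded_byD (bounded_byZ a gl) gl'); rewrite [leRHS]splitr lerD2r.
rewrite mulrA ler_pdivrMr // mulrDr mulr1 [leLHS]mulrC lerDl ltW //.
Qed.

Lemma rkhs_set_bounded g : rkhs_set g -> exists2 M, 0 <= M & bounded_by g M.
Proof.
move=> /(_ 1 ltr01)[l gl]; exists (1 + seminorm l).
  by rewrite addr_ge0 ?seminorm_ge0.
by rewrite -[g](subrK (kcomb l)); apply: bounded_byD => //; apply: bounded_kcomb.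
Qed.

(** Two approximations of [g'] are close to each other in the seminorm, and [g] is
    bounded for it. *)
Lemma kpairing_dist g M g' l e l' e' : 0 <= M -> 0 <= e -> 0 <= e' ->
  bounded_by g M -> bounded_by (g' - kcomb l) e -> bounded_by (g' - kcomb l') e' ->
  `|kpairing g l - kpairing g l'| <= M * (e + e').
Proof.
move=> M0 e0 e'0 gM gl gl'.
have -> : kpairing g l - kpairing g l' = kpairing g (l ++ kscale (-1) l').
  by rewrite kpairing_cat kpairing_scale rmorphN1 mulN1r.
rewrite (le_trans (gM _)) // ler_wpM2l //; apply: seminorm_le.
  exact: addr_ge0.
rewrite kcomb_cat kcomb_scale scaleN1r [e + e']addrC.
rewrite (_ : _ + _ = (g' - kcomb l') - (g' - kcomb l)); first exact: bounded_byB.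
by rewrite opprB [RHS]addrC addrA subrK.
Qed.

End Kernels.

Section Rkhs.
Variables (R : realType) (X : Type).
Local Notation K := (R[i] : numClosedFieldType).
Variable k : psd_kernel K X.

Definition rkhs_pred : {pred X -> K^o} := fun g => `[< rkhs_set k g >].

Lemma rkhs_pred_submod : GRing.submod_closed rkhs_pred.
Proof.
split.
  apply/asboolP; rewrite (_ : 0 = kcomb k [::]); first exact: kcomb_rkhs.
  by apply/funext => x; rewrite /kcomb big_nil.
by move=> a g g' /asboolP gH /asboolP g'H; apply/asboolP/rkhs_setP.
Qed.

Record rkhs := Rkhs { rkhs_fun : X -> K^o ; _ : rkhs_fun \in rkhs_pred }.

HB.instance Definition _ := [isSub for rkhs_fun].
HB.instance Definition _ := [Choice of rkhs by <:].
HB.instance Definition _ := GRing.SubChoice_isSubLmodule.Build K (X -> K^o)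
  rkhs_pred rkhs (GRing.submod_closed_semi rkhs_pred_submod).

Implicit Types f g : rkhs.

Lemma rkhsP g : rkhs_set k (val g).
Proof. by case: g => g /= /asboolP. Qed.

Definition approx g n : seq (K * X) := sval (cid (rkhsP g (invS_gt0 _ n))).

Lemma approxP g n : bounded_by k (val g - kcomb k (approx g n)) n.+1%:R^-1.
Proof. exact: svalP (cid (rkhsP g (invS_gt0 _ n))). Qed.

Definition rkhs_dot f g : K := limn (fun n => kpairing (val f) (approx g n)).

Lemma rkhs_dot_cvg f g : (fun n => kpairing (val f) (approx g n)) @ \oo --> rkhs_dot f g.
Proof.
suff : cvgn (fun n => kpairing (val f) (approx g n)) by [].
have [M M0 fM] := rkhs_set_bounded (rkhsP f).
apply: cauchy_seq_cvg_complex => e e0.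
have M1 : 0 < M + 1 by rewrite ltr_wpDl.
have [|N HN] := @invS_small R (e / 2 / (M + 1)); first by rewrite !divr_gt0.
exists N => n /HN hn; have hN := HN N (leqnn _).
rewrite (le_lt_trans (kpairing_dist M0 (ltW (invS_gt0 _ N)) (ltW (invS_gt0 _ n)) fM
  (@approxP g N) (@approxP g n))) //.
have h : N.+1%:R^-1 + n.+1%:R^-1 < e / (M + 1).
  by rewrite [ltRHS](_ : _ = e / 2 / (M + 1) + e / 2 / (M + 1)) ?ltrD //; field;
    rewrite gt_eqF.
apply: le_lt_trans (ler_wpM2l M0 (ltW h)) _.
rewrite mulrA ltr_pdivrMr // mulrC ltr_pM2l // ltrDl; exact: ltr01.
Qed.

(** Every other approximation of [g] computes the same number. *)
Lemma rkhs_dot_approx f g M l e : 0 <= M -> 0 <= e -> bounded_by k (val f) M ->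
  bounded_by k (val g - kcomb k l) e -> `|rkhs_dot f g - kpairing (val f) l| <= M * e.
Proof.
move=> M0 e0 fM gl; apply/ler_addgt0Pr => d d0.
have M1 : 0 < M + 1 by rewrite ltr_wpDl.
have d2 : 0 < d / 2 by rewrite divr_gt0.
have [N HN] := invS_small (divr_gt0 d2 M1).
have /cvgn_distP/(_ _ d2)[N' HN'] := @rkhs_dot_cvg f g.
pose n := maxn N N'; rewrite -[rkhs_dot f g](subrK (kpairing (val f) (approx g n))).
rewrite -addrA (le_trans (ler_normD _ _)) //.
have h1 := HN' n (leq_maxr _ _).
have h2 := kpairing_dist M0 (ltW (invS_gt0 _ n)) e0 fM (@approxP g n) gl.
have h3 : M * n.+1%:R^-1 <= d / 2.
  apply: le_trans (ler_wpM2l M0 (ltW (HN n (leq_maxl _ _)))) _.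
  by rewrite mulrA ler_pdivrMr // mulrC ler_pM2l // lerDl ler01.
rewrite (le_trans (lerD (ltW h1) h2)) // mulrDr addrA addrC lerD2l.
by rewrite [leRHS]splitr lerD2l.
Qed.

Lemma rkhs_dotPl a f f' g : rkhs_dot (a *: f + f') g = a * rkhs_dot f g + rkhs_dot f' g.
Proof.
have fg := @rkhs_dot_cvg f g; have f'g := @rkhs_dot_cvg f' g.
apply: (cvgn_unique (@rkhs_dot_cvg (a *: f + f') g)).
rewrite (_ : (fun n => _) = fun n => a * kpairing (val f) (approx g n) +
    kpairing (val f') (approx g n)); last first.
  by apply/funext => n; rewrite -kpairingZ -kpairingD.
exact: cvgD (cvgM (cvg_cst a) fg) f'g.
Qed.

Lemma seminorm_approx g M l e : bounded_by k (val g) M ->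
  bounded_by k (val g - kcomb k l) e ->
  0 <= M -> 0 <= e -> seminorm k l <= M + e.
Proof.
move=> gM gl M0 e0; apply: seminorm_le; first exact: addr_ge0.
by rewrite -[kcomb k l](subKr (val g)); apply: bounded_byB.
Qed.

(** The inner product is a limit of values of the form, from which it inherits
    symmetry and positivity. *)
Lemma rkhs_dot_kform f g M M' l l' e : 0 <= M -> 0 <= M' -> 0 <= e -> e <= 1 ->
  bounded_by k (val f) M -> bounded_by k (val g) M' ->
  bounded_by k (val f - kcomb k l) e -> bounded_by k (val g - kcomb k l') e ->
  `|rkhs_dot f g - kform k l l'| <= (M + M' + 1) * e.
Proof.
move=> M0 M'0 e0 e1 fM gM' fl gl'.
rewrite -[rkhs_dot f g](subrK (kpairing (val f) l')) -addrA (le_trans (ler_normD _ _)) //.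
rewrite -addrA mulrDl lerD //; first exact: rkhs_dot_approx.
rewrite -kpairing_kcomb -kpairingB (le_trans (fl _)) // mulrC ler_wpM2r //.
by rewrite (le_trans (seminorm_approx gM' gl' _ _)) // lerD2l.
Qed.

Let approx1 f g (e : K) : 0 < e -> exists l l' d,
  [/\ 0 <= d, d <= 1, d <= e, bounded_by k (val f - kcomb k l) d &
      bounded_by k (val g - kcomb k l') d].
Proof.
move=> e0; have [N HN] := invS_small e0.
exists (approx f N), (approx g N), N.+1%:R^-1; split; last exact: approxP.
- exact: ltW (invS_gt0 _ N).
- by rewrite invf_le1 ?ltr0Sn // ler1n.
- exact: ltW (HN N (leqnn _)).
exact: approxP.
Qed.

Lemma rkhs_dotC f g : rkhs_dot f g = (rkhs_dot g f)^*.
Proof.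
have [M M0 fM] := rkhs_set_bounded (rkhsP f).
have [M' M'0 gM'] := rkhs_set_bounded (rkhsP g).
apply/eqP; rewrite -subr_eq0; apply/eqP.
apply: (@eq0_small _ _ ((M + M' + 1) + (M' + M + 1))) => e e0.
have [l [l' [d [d0 d1 de fl gl']]]] := approx1 f g e0.
have h1 := rkhs_dot_kform M0 M'0 d0 d1 fM gM' fl gl'.
have h2 := rkhs_dot_kform M'0 M0 d0 d1 gM' fM gl' fl.
rewrite -[rkhs_dot f g](subrK (kform k l l')) -addrA (le_trans (ler_normD _ _)) //.
rewrite mulrDl lerD ?(le_trans h1) ?ler_wpM2l ?addr_ge0 //.
by rewrite kformC -rmorphB norm_conjC distrC (le_trans h2) // ler_wpM2l ?addr_ge0.
Qed.

Lemma rkhs_dot_ge0 f : 0 <= rkhs_dot f f.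
Proof.
have [M M0 fM] := rkhs_set_bounded (rkhsP f).
apply: (@ge0_approx _ _ (M + M + 1)) => e e0.
have [l [_ [d [d0 d1 de fl _]]]] := approx1 f f e0.
exists (kform k l l); first exact: kform_ge0.
rewrite (le_trans (rkhs_dot_kform M0 M0 d0 d1 fM fM fl fl)) //.
by rewrite ler_wpM2l ?addr_ge0.
Qed.

Lemma kcomb_mem l : kcomb k l \in rkhs_pred.
Proof. exact/asboolP/kcomb_rkhs. Qed.

Definition rkhs_comb l : rkhs := Rkhs (kcomb_mem l).

Lemma rkhs_dot_comb f l : rkhs_dot f (rkhs_comb l) = kpairing (val f) l.
Proof.
have [M M0 fM] := rkhs_set_bounded (rkhsP f).
apply/eqP; rewrite -subr_eq0; apply/eqP/(@eq0_small _ _ M) => e e0.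
apply: rkhs_dot_approx => //; first exact: ltW.
move=> l'; rewrite kpairingB subrr normr0 mulr_ge0 ?seminorm_ge0 //; exact: ltW.
Qed.

Lemma rkhs_dotDl f f' g : rkhs_dot (f + f') g = rkhs_dot f g + rkhs_dot f' g.
Proof. by rewrite -[f]scale1r rkhs_dotPl mul1r scale1r. Qed.

Lemma rkhs_dot0l g : rkhs_dot 0 g = 0.
Proof. by apply: (addrI (rkhs_dot 0 g)); rewrite -rkhs_dotDl !addr0. Qed.

Lemma rkhs_dotZl a f g : rkhs_dot (a *: f) g = a * rkhs_dot f g.
Proof. by rewrite -[a *: f]addr0 rkhs_dotPl rkhs_dot0l addr0. Qed.

Lemma rkhs_dotDr f g g' : rkhs_dot f (g + g') = rkhs_dot f g + rkhs_dot f g'.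
Proof. by rewrite rkhs_dotC rkhs_dotDl rmorphD /= -!rkhs_dotC. Qed.

Lemma rkhs_dotZr a f g : rkhs_dot f (a *: g) = a^* * rkhs_dot f g.
Proof. by rewrite rkhs_dotC rkhs_dotZl rmorphM /= -rkhs_dotC. Qed.

Lemma rkhs_cauchy_schwarz f g : `|rkhs_dot f g| ^+ 2 <= rkhs_dot f f * rkhs_dot g g.
Proof.
exact: (cauchy_schwarz_form _ _ rkhs_dotPl rkhs_dotC rkhs_dot_ge0).
Qed.

Lemma rkhs_dot_eq0 f : rkhs_dot f f = 0 -> f = 0.
Proof.
move=> f0; apply/val_inj/funext => x.
have := rkhs_cauchy_schwarz f (rkhs_comb [:: (1, x)]).
rewrite f0 mul0r rkhs_dot_comb /kpairing big_seq1 conjC1 mul1r => h.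
by apply/eqP; rewrite -normr_eq0 -sqrf_eq0 eq_le h exprn_ge0.
Qed.

Definition rkhs_norm f := sqrtC (rkhs_dot f f).

Lemma rkhs_norm_ge0 f : 0 <= rkhs_norm f.
Proof. by rewrite sqrtC_ge0 rkhs_dot_ge0. Qed.

Lemma rkhs_norm_sqr f : rkhs_norm f ^+ 2 = rkhs_dot f f.
Proof. exact: sqrtCK. Qed.

Lemma rkhs_norm_comb l : rkhs_norm (rkhs_comb l) = seminorm k l.
Proof. by rewrite /rkhs_norm rkhs_dot_comb kpairing_kcomb. Qed.

(* Unification would otherwise compute with complex square roots. *)
Opaque rkhs_norm rkhs_dot.

Lemma rkhs_normZ a f : rkhs_norm (a *: f) = `|a| * rkhs_norm f.
Proof.
apply: (norm_scale (rkhs_norm_ge0 _) (rkhs_norm_ge0 _) (rkhs_norm_sqr _)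
  (rkhs_norm_sqr _)).
by rewrite rkhs_dotZl rkhs_dotZr.
Qed.

Lemma rkhs_dot_le f g : `|rkhs_dot f g| <= rkhs_norm f * rkhs_norm g.
Proof.
exact: (norm_le_mul (rkhs_norm_ge0 _) (rkhs_norm_ge0 _) (rkhs_norm_sqr _)
  (rkhs_norm_sqr _) (rkhs_cauchy_schwarz _ _)).
Qed.

Lemma rkhs_norm0_eq0 f : rkhs_norm f = 0 -> f = 0.
Proof. by move=> f0; apply: rkhs_dot_eq0; rewrite -rkhs_norm_sqr f0 expr0n. Qed.

Lemma bounded_by_norm f : bounded_by k (val f) (rkhs_norm f).
Proof. by move=> l; rewrite -rkhs_dot_comb -rkhs_norm_comb rkhs_dot_le. Qed.

(** [rkhs_norm f ^+ 2] is approached by values of the functional of [f] at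
    combinations whose seminorm approaches [rkhs_norm f]. *)
Lemma rkhs_norm_le f e : 0 <= e -> bounded_by k (val f) e -> rkhs_norm f <= e.
Proof.
move=> e0 fe; have [->//|fN0] := eqVneq (rkhs_norm f) 0.
have fp : 0 < rkhs_norm f by rewrite lt0r fN0 rkhs_norm_ge0.
rewrite -(ler_pM2r fp) -expr2 rkhs_norm_sqr; apply/ler_addgt0Pr => d d0.
have c0 : 0 < rkhs_norm f + e by rewrite ltr_pwDl.
have [l [_ [r [r0 _ rd fl _]]]] := approx1 f f (divr_gt0 d0 c0).
have h1 := rkhs_dot_approx (ltW fp) r0 (bounded_by_norm f) fl.
have h2 := seminorm_approx (bounded_by_norm f) fl (ltW fp) r0.
rewrite -[leLHS]ger0_norm ?rkhs_dot_ge0 // -[rkhs_dot f f](subrK (kpairing (val f) l)).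
rewrite (le_trans (ler_normD _ _)) // (le_trans (lerD h1 (fe l))) //.
rewrite (le_trans (lerD (lexx _) (ler_wpM2l e0 h2))) // mulrDr addrCA lerD2l.
by rewrite -mulrDl (le_trans (ler_wpM2l (ltW c0) rd)) // mulrC divfK ?gt_eqF.
Qed.

Lemma rkhs_normD f g : rkhs_norm (f + g) <= rkhs_norm f + rkhs_norm g.
Proof.
apply: rkhs_norm_le; first by rewrite addr_ge0 ?rkhs_norm_ge0.
by apply: bounded_byD; apply: bounded_by_norm.
Qed.

HB.instance Definition _ :=
  Lmodule_isNormed.Build (R[i] : numFieldType) rkhs rkhs_normD rkhs_normZ rkhs_norm0_eq0.

Lemma rkhs_normE f : `|f| = rkhs_norm f.
Proof. by []. Qed.

(** Values at a point are bounded by the norm, so the pointwise limit exists; the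
    bounds on the functionals pass to it. *)
Lemma rkhs_limit (u : nat -> rkhs) (e : nat -> K) :
  (forall n m, (n <= m)%N -> bounded_by k (val (u m) - val (u n)) (e n)) ->
  (forall n, 0 <= e n) -> (forall d : K, 0 < d -> exists n, e n < d) ->
  exists g : rkhs, forall n, rkhs_norm (g - u n) <= e n.
Proof.
move=> ue e0 esmall.
have ucvg x : cvgn (fun n => val (u n) x : K).
  apply: cauchy_seq_cvg_complex => d d0.
  pose q := seminorm k [:: (1, x)].
  have q1 : 0 < q + 1 by rewrite ltr_wpDl ?seminorm_ge0.
  have [N HN] := esmall _ (divr_gt0 d0 q1); exists N => n Nn.
  have := ue N n Nn [:: (1, x)]; rewrite /kpairing big_seq1 conjC1 mul1r distrC.
  move/le_lt_trans; apply; apply: (@le_lt_trans _ _ (e N * (q + 1))).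
    by rewrite ler_wpM2l // lerDl ler01.
  by rewrite -ltr_pdivlMr.
pose g x : K := limn (fun n => val (u n) x : K).
have pcvg n l : (fun m => kpairing (val (u m) - val (u n)) l) @ \oo -->
    kpairing ((g : X -> K^o) - val (u n)) l.
  rewrite /kpairing (_ : (fun m => _) = fun m =>
    \sum_(q <- l) q.1^* * (val (u m) q.2 - val (u n) q.2)) //.
  apply: cvgn_sum => q; apply: cvgM; first exact: cvg_cst.
  by apply: cvgB; [exact: ucvg|exact: cvg_cst].
have gu n : bounded_by k ((g : X -> K^o) - val (u n)) (e n).
  move=> l; have /cvgn_distP H := pcvg n l.
  apply/ler_addgt0Pl => d d0; have [N HN] := H d d0.
  have h := HN _ (leq_maxl N n).
  rewrite -[kpairing _ l](subrK (kpairing (val (u (maxn N n)) - val (u n)) l)).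
  rewrite (le_trans (ler_normD _ _)) // lerD ?(ltW h) //.
  exact: (ue n _ (leq_maxr _ _) l).
have gH : g \in rkhs_pred.
  apply/asboolP => d d0; have d2 : 0 < d / 2 by rewrite divr_gt0.
  have [n en] := esmall _ d2; have [l ul] := rkhsP (u n) d2; exists l.
  rewrite (_ : _ - _ = (g : X -> K^o) - val (u n) + (val (u n) - kcomb k l)).
    by apply: bounded_by_le (bounded_byD (gu n) ul); rewrite [leRHS]splitr lerD2r ltW.
  by rewrite addrA subrK.
by exists (Rkhs gH) => n; apply: rkhs_norm_le => //; apply: gu.
Qed.

Lemma rkhs_complete (F : set_system rkhs) : ProperFilter F -> cauchy F -> cvg F.
Proof.
move=> FF /cauchyP Fc.
have /choice[u Fu] : forall n, exists g : rkhs, F (ball g (n.+1%:R^-1 : K)).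
  by move=> n; apply: Fc; exact: invS_gt0.
have fin n : 0 <= (n.+1%:R^-1 : K) by exact: ltW (invS_gt0 _ n).
have ue n m : (n <= m)%N -> bounded_by k (val (u m) - val (u n)) (n.+1%:R^-1 *+ 2).
  move=> nm; apply: bounded_by_le (bounded_by_norm (u m - u n)); rewrite -rkhs_normE.
  have [f [fn fm]] := @filter_ex _ F _ _ (filterI (Fu n) (Fu m)).
  rewrite -[u m](subrK f) -addrA (le_trans (ler_normD _ _)) // mulr2n.
  move: fn fm; rewrite -!ball_normE /= => fn fm.
  apply: lerD; last by rewrite distrC; exact: ltW fn.
  exact: le_trans (ltW fm) (invS_le _ nm).
have e0 n : 0 <= (n.+1%:R^-1 : K) *+ 2 by rewrite mulrn_wge0.
have [d d0|g gu] := rkhs_limit ue e0.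
  have [|N HN] := @invS_small R (d / 2); first by rewrite divr_gt0.
  exists N; have h := HN N (leqnn _).
  by rewrite [ltRHS]splitr mulr2n ltrD.
apply/cvg_ex; exists g; apply/cvgrPdist_lt => e e1.
have [|N HN] := @invS_small R (e / 3); first by rewrite divr_gt0.
have h := HN N (leqnn _); apply: filterS (Fu N) => f.
rewrite -ball_normE /= => fN.
rewrite -[g](subrK (u N)) -addrA (le_lt_trans (ler_normD _ _)) //.
have -> : e = e / 3 + e / 3 + e / 3 by field.
apply: ltrD; last exact: lt_trans fN h.
by rewrite (le_lt_trans (gu N)) // mulr2n ltrD.
Qed.

HB.instance Definition _ := Uniform_isComplete.Build rkhs rkhs_complete.

Lemma rkhs_dotBl g : zmod_morphism (rkhs_dot^~ g).
Proof. by move=> f f'; rewrite -scaleN1r rkhs_dotDl rkhs_dotZl mulN1r. Qed.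

Lemma rkhs_dotBr f : zmod_morphism (rkhs_dot f).
Proof. by move=> g g'; rewrite -scaleN1r rkhs_dotDr rkhs_dotZr rmorphN1 mulN1r. Qed.

Lemma rkhs_dot_scalablel g : scalable_for ( *%R ) (rkhs_dot^~ g).
Proof. by move=> a f; apply: rkhs_dotZl. Qed.

Lemma rkhs_dot_scalabler f : scalable_for (Num.conj \; *%R) (rkhs_dot f).
Proof. by move=> a g; apply: rkhs_dotZr. Qed.

HB.instance Definition _ := @isBilinear.Build K rkhs rkhs K
  ( *%R ) (Num.conj \; *%R) rkhs_dot rkhs_dotBl rkhs_dotBr
  rkhs_dot_scalablel rkhs_dot_scalabler.

Lemma rkhs_dot_hermitian f g : rkhs_dot f g = (-1) ^+ false * (rkhs_dot g f)^*.
Proof. by rewrite expr0 mul1r rkhs_dotC. Qed.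

HB.instance Definition _ := @isHermitianSesquilinear.Build K rkhs false Num.conj
  rkhs_dot rkhs_dot_hermitian.

Lemma rkhs_dot_gt0 f : f != 0 -> 0 < rkhs_dot f f.
Proof.
by move=> f0; rewrite lt0r rkhs_dot_ge0 andbT; apply: contra_neq f0; apply: rkhs_dot_eq0.
Qed.

HB.instance Definition _ := @isDotProduct.Build K rkhs rkhs_dot rkhs_dot_gt0.

HB.instance Definition _ :=
  @CompleteNormedModule_isHilbert.Build K rkhs rkhs_dot rkhs_norm_sqr.

Lemma hdot_rkhs_comb (f : rkhs) l : <[f, rkhs_comb l]> = kpairing (val f) l.
Proof. exact: rkhs_dot_comb. Qed.

Lemma rkhs_approx (f : rkhs) (e : K) : 0 < e -> exists l, `|f - rkhs_comb l| <= e.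
Proof.
move=> e0; have [l fl] := rkhsP f e0; exists l; rewrite rkhs_normE.
by apply: rkhs_norm_le; first exact: ltW.
Qed.

End Rkhs.

Section PositiveKernels.
Variables (K : numClosedFieldType) (X : Type).
Implicit Types (k : X -> X -> K).

Lemma psd_ext k k' : (forall x y, k x y = k' x y) -> psd k -> psd k'.
Proof. by move=> kk'; suff -> : k = k' by []; apply/funext => x; apply/funext. Qed.

Lemma psdD k k' : psd k -> psd k' -> psd (fun x y => k x y + k' x y).
Proof.
move=> [kC k0] [k'C k'0]; split=> [x y|l]; first by rewrite kC k'C rmorphD.
rewrite /kform (_ : \sum_(_ <- _) _ = kform k l l + kform k' l l) ?addr_ge0 //.
rewrite /kform -big_split; apply: eq_bigr => p _; rewrite -big_split.
by apply: eq_bigr => q _; rewrite mulrDr.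
Qed.

Lemma psd0 : psd (fun _ _ : X => 0 : K).
Proof.
split=> [x y|l]; first by rewrite conjC0.
by apply: sumr_ge0 => p _; apply: sumr_ge0 => q _; rewrite mulr0.
Qed.

Lemma psd_sum (I : Type) (r : seq I) (k : I -> X -> X -> K) :
  (forall i, psd (k i)) -> psd (fun x y => \sum_(i <- r) k i x y).
Proof.
move=> kP; elim: r => [|i r IH].
  by apply: psd_ext psd0 => x y; rewrite big_nil.
by apply: psd_ext (psdD (kP i) IH) => x y; rewrite big_cons.
Qed.

(** Multiplying by the rank-one kernel of [a] amounts to rescaling the
    coefficients. *)
Lemma psd_scale (a : X -> K) k : psd k -> psd (fun x y => a x * (a y)^* * k x y).
Proof.
move=> [kC k0]; split=> [x y|l].
  by rewrite !rmorphM /= conjCK -kC [(a y)^* * _]mulrC.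
have := k0 [seq (p.1 * a p.2, p.2) | p <- l]; rewrite /kform big_map.
set s := \sum_(_ <- _) _; set t := \sum_(_ <- _) _; suff -> : s = t by [].
apply: eq_bigr => p _; rewrite big_map; apply: eq_bigr => q _ /=.
by rewrite rmorphM /=; ring.
Qed.

(** The indicator of an equivalence relation is positive: its quadratic form is
    the sum over the classes of the squared moduli of the sums of
    coefficients. *)
Lemma psd_class (Y : eqType) (r : X -> Y) : psd (fun x y => (r x == r y)%:R : K).
Proof.
split=> [x y|l]; first by rewrite eq_sym conjC_nat.
pose U := undup [seq r p.2 | p <- l].
pose S y := \sum_(p <- l) p.1 * (r p.2 == y)%:R : K.
suff -> : kform (fun x y => (r x == r y)%:R) l l = \sum_(y <- U) S y * (S y)^*.
  by apply: sumr_ge0 => y _; apply: mul_conjC_ge0.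
transitivity (\sum_(p <- l) \sum_(q <- l) \sum_(y <- U)
    p.1 * q.1^* * ((r p.2 == y)%:R * (r q.2 == y)%:R)).
  have lU : all (fun p => r p.2 \in U) l.
    have : all (mem U) [seq r p.2 | p <- l].
      by apply/allP => y; rewrite /= mem_undup.
    by rewrite all_map.
  rewrite /kform -(all_filterP lU) !big_filter; apply: eq_bigr => p pU.
  rewrite !big_filter; apply: eq_bigr => q _; rewrite -mulr_sumr; congr (_ * _).
  rewrite (bigD1_seq (r p.2)) ?undup_uniq //=.
  rewrite eqxx mul1r eq_sym big1 ?addr0 // => y.
  by rewrite eq_sym => /negbTE->; rewrite mul0r.
under eq_bigr => p _ do rewrite exchange_big.
rewrite exchange_big; apply: eq_bigr => y _ /=.
rewrite /S mulr_suml; apply: eq_bigr => p _.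
rewrite rmorph_sum mulr_sumr; apply: eq_bigr => q _ /=.
by rewrite rmorphM /= conjC_nat; ring.
Qed.

End PositiveKernels.

Lemma psd_limit (K : numClosedFieldType) (X : Type) (k : nat -> X -> X -> K) k' :
  (forall N, psd (k N)) -> (forall x y, (fun N => k N x y) @ \oo --> k' x y) ->
  psd k'.
Proof.
move=> kP kk'; split=> [x y|l].
  apply: (cvgn_unique (kk' x y)); apply/cvgn_distP => e e0.
  have /cvgn_distP/(_ e e0)[N HN] := kk' y x; exists N => n /HN.
  rewrite [k n x y](kP n).1.
  suff -> : (k' y x)^* - (k n y x)^* = (k' y x - k n y x)^* by rewrite norm_conjC.
  by rewrite rmorphB.
have cvgk : (fun N => kform (k N) l l) @ \oo --> kform k' l l.
  apply: cvgn_sum => p; apply: cvgn_sum => q; apply: cvgM; first exact: cvg_cst.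
  exact: kk'.
by apply: (cvgn_ge0 cvgk) => N; apply: (kP N).2.
Qed.

(** * C-sequences *)

Section Summable.
Variable R : realType.
Local Notation K := (R[i] : numClosedFieldType).
Implicit Types (v w : nat -> K).

Lemma series_cvg_le v w : (forall n, 0 <= v n <= w n) ->
  cvgn (series w) -> cvgn (series v).
Proof.
move=> vw.
have v0 n : 0 <= v n by case/andP: (vw n).
have w0 n : 0 <= w n by case/andP: (vw n) => /le_trans; apply.
move=> /(series_cvgP w0)[M wM]; apply/(series_cvgP v0); exists M => N.
by apply: le_trans (wM N); apply: ler_sum => n _; case/andP: (vw n).
Qed.

Lemma series_cvgD v w : cvgn (series v) -> cvgn (series w) ->
  cvgn (series (fun n => v n + w n)).
Proof. exact: is_cvg_seriesD. Qed.

Lemma series_cvgZ a w : cvgn (series w) -> cvgn (series (fun n => a * w n)).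
Proof. exact: (@is_cvg_seriesZ (R[i] : numFieldType) w a). Qed.

(** Factors that an unconditionally convergent product dominates are its own
    factors times numbers of the unit interval. *)
Lemma uprod_cvg_dominated v w a : uprod_cvg w a ->
  (forall n, 0 <= v n <= w n) -> exists b, uprod_cvg v b.
Proof.
move=> wa vw.
have w0 n : 0 <= w n by case/andP: (vw n) => /le_trans; apply.
have [n|c uc] := @uprod_cvg_le1 R (fun n => v n / w n).
  case/andP: (vw n) => v0 vwn; rewrite divr_ge0 //=.
  have [->|wn] := eqVneq (w n) 0; first by rewrite invr0 mulr0 ler01.
  by rewrite ler_pdivrMr ?mul1r // lt0r wn w0.
exists (a * c); rewrite (_ : v = fun n => w n * (v n / w n)).
  exact: (uprod_cvgM wa uc).
apply/funext => n; have [wn|wn] := eqVneq (w n) 0; last first.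
  by rewrite mulrCA divff // mulr1.
by have := vw n; rewrite wn mul0r -eq_le eq_sym => /eqP.
Qed.

End Summable.

Section CSequences.
Variables (R : realType) (H : nat -> hilbertType R[i]).
Local Notation K := (R[i] : numClosedFieldType).
Implicit Types h f g : forall n, H n.

Lemma C_sequence_dominated (H' : nat -> hilbertType R[i]) h (h' : forall n, H' n) :
  C_sequence h -> (forall n, `|h' n| <= `|h n|) -> C_sequence h'.
Proof.
move=> [a ha] h'h; apply: (uprod_cvg_dominated ha) => n.
by rewrite !normr_id normr_ge0 h'h.
Qed.

Lemma C_sequence_cvg h : C_sequence h ->
  exists a : K, uprod_cvg (fun n => `|h n|) a.
Proof.
by move=> [a ha]; exists a; under eq_fun do rewrite -normr_id.
Qed.

Lemma C_sequence_hdot_cvg h : C_sequence h ->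
  exists a : K, uprod_cvg (fun n => <[h n, h n]>) a.
Proof.
move=> /C_sequence_cvg[a ha]; exists (a * a).
under eq_fun do rewrite -hdot_normE expr2; exact: (uprod_cvgM ha ha).
Qed.

Lemma C0_sequence_neq0 h (a : K) : uprod_cvg (fun n => `|h n|) a -> a != 0 ->
  C0_sequence h.
Proof.
move=> ha a0; split; first by exists a; under eq_fun do rewrite normr_id.
exact: uprod_cvg_abs ha a0.
Qed.

(** [1 - t ^+ 2 = (1 + t) * (1 - t)], where [1 + t] stays bounded. *)
Lemma C0_equiv_refl h : C0_sequence h -> C0_equiv h h.
Proof.
move=> [_ hs]; have /series_cvgP[n|M hM] := hs; first exact: normr_ge0.
apply: series_cvg_le (@series_cvgZ _ (2 + M) _ hs) => n; rewrite normr_ge0 /=.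
rewrite -hdot_normE (_ : 1 - _ = (1 + `|h n|) * (1 - `|h n|)); last by ring.
rewrite normrM ler_wpM2r // (_ : 1 + _ = 2 - (1 - `|h n|)); last by ring.
rewrite (le_trans (ler_normB _ _)) // normr_nat lerD2l.
apply: le_trans (hM n.+1); rewrite big_ord_recr /= lerDr.
by apply: sumr_ge0 => i _; apply: normr_ge0.
Qed.

Lemma C0_equiv_sym h f : C0_equiv h f -> C0_equiv f h.
Proof.
rewrite /C0_equiv.
suff -> : (fun n => `|1 - <[f n, h n]>| : K) = fun n => `|1 - <[h n, f n]>| by [].
by apply/funext => n; rewrite (hdotC (h n)) -norm_conjC rmorphB rmorph1.
Qed.

(** For equivalent C_0-sequences the squared distances are summable, and
    [<h - f, g - f>] relates the three inner products to [<f, f>]. *)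
Lemma C0_equiv_trans h f g : C0_sequence h -> C0_sequence f -> C0_sequence g ->
  C0_equiv h f -> C0_equiv f g -> C0_equiv h g.
Proof.
move=> h0 f0 g0 hf fg.
have dist h' f' : C0_sequence h' -> C0_sequence f' -> C0_equiv h' f' ->
    cvgn (series (fun n => `|h' n - f' n| ^+ 2)).
  move=> h'0 f'0 e; apply: series_cvg_le (series_cvgD
    (series_cvgD (C0_equiv_refl h'0) (C0_equiv_refl f'0))
    (series_cvgD e (C0_equiv_sym e))) => n.
  rewrite exprn_ge0 //= -[leLHS]ger0_norm ?exprn_ge0 //.
  rewrite hdot_normE hdotBl !hdotBr (_ : _ - _ - _ =
    - (1 - <[h' n, h' n]>) - (1 - <[f' n, f' n]>)
    + ((1 - <[h' n, f' n]>) + (1 - <[f' n, h' n]>))); last by ring.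
  rewrite (le_trans (ler_normD _ _)) // lerD ?ler_normD //.
  by rewrite (le_trans (ler_normB _ _)) // normrN.
apply: series_cvg_le (series_cvgD (series_cvgD hf fg) (series_cvgD
  (C0_equiv_refl f0) (series_cvgD (dist _ _ h0 f0 hf)
    (dist _ _ g0 f0 (C0_equiv_sym fg))))) => n; rewrite normr_ge0 /=.
rewrite (_ : 1 - _ = (1 - <[h n, f n]>) + (1 - <[f n, g n]>)
   - ((1 - <[f n, f n]>) + <[h n - f n, g n - f n]>)); last first.
  by rewrite hdotBl !hdotBr; ring.
rewrite (le_trans (ler_normB _ _)) // lerD ?ler_normD //.
rewrite (le_trans (ler_normD _ _)) // lerD2l.
rewrite (le_trans (hdot_cauchy_schwarz _ _)) //.
have := normr_ge0 (h n - f n); have := normr_ge0 (g n - f n).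
move: `|_| `|_| => s t s0 t0.
have := real_comparable (ger0_real s0) (ger0_real t0).
case/orP => st; rewrite expr2.
  by rewrite -[leLHS]addr0 lerD ?mulr_ge0 // ler_wpM2l.
by rewrite expr2 -[leLHS]add0r lerD ?mulr_ge0 // ler_wpM2r.
Qed.

Lemma C0_equiv_uprod_cvg h f : C0_equiv h f ->
  uprod_cvg (fun n => <[h n, f n]>) (qprod (fun n => <[h n, f n]> : K)).
Proof. by move=> /abs_uprod_cvg[a ha]; rewrite (qprodE ha). Qed.

(** A nonzero value of the product bounds both norm products away from 0, and
    its unconditional convergence is absolute. *)
Lemma qprod_hdot_neq0 h f : C_sequence h -> C_sequence f ->
  qprod (fun n => <[h n, f n]> : K) <> 0 ->
  [/\ C0_sequence h, C0_sequence f & C0_equiv h f].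
Proof.
move=> /C_sequence_cvg[a ha] /C_sequence_cvg[b fb]; rewrite /qprod.
case: xgetP => [c -> /= zc /eqP c0|_ //].
have ab : a * b != 0.
  apply: contra_neq c0 => ab0.
  apply: (uprod_cvg_unique zc); apply: uprod_cvg0_dominated.
    by rewrite -ab0; exact: (uprod_cvgM ha fb).
  move=> n; rewrite normrM !normr_id; exact: hdot_cauchy_schwarz.
move: ab; rewrite mulf_eq0 negb_or => /andP[a0 b0].
split; first exact: C0_sequence_neq0 ha a0.
  exact: C0_sequence_neq0 fb b0.
exact: uprod_cvg_abs zc c0.
Qed.

End CSequences.

(** * Existence of the complete tensor product *)

Section Existence.
Variables (R : realType) (H : nat -> hilbertType R[i]).
Local Notation K := (R[i] : numClosedFieldType).
Variables (I : Type) (r : seq I) (b : forall n, I -> H n).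
Hypothesis parseval : forall n (x y : H n),
  <[x, y]> = \sum_(i <- r) <[x, b n i]> * <[y, b n i]>^*.

(** The class is compared by [==] in [psd_class], which needs the classical
    equality of the type of sets. *)
Definition C0_class (h : forall n, H n) : {classic (set (forall n, H n))} :=
  [set f | C0_sequence f /\ C0_equiv h f].

Lemma C0_class_eq h f : C0_sequence h -> C0_sequence f ->
  C0_class h = C0_class f <-> C0_equiv h f.
Proof.
move=> h0 f0; split=> [E|hf].
  have : C0_class f f := conj f0 (C0_equiv_refl f0).
  by rewrite -E => -[].
apply/seteqP; split=> g [g0 gE]; split; [exact: g0| |exact: g0|].
  exact: C0_equiv_trans f0 h0 g0 (C0_equiv_sym hf) gE.
exact: C0_equiv_trans h0 f0 g0 hf gE.
Qed.

Definition tensor_kernel (u v : Cseq H) : K :=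
  qprod (fun n => <[sval u n, sval v n]>).

(** Inside one equivalence class the kernel is a limit of finite products of
    inner products, which are sums of rank-one kernels times a positive one;
    between classes it vanishes, hence the indicator of equivalence. *)
Lemma psd_tensor_kernel : psd tensor_kernel.
Proof.
pose a (u : Cseq H) : K := `[< C0_sequence (sval u) >]%:R.
have a1 u : C0_sequence (sval u) -> a u = 1 by rewrite /a; case: asboolP.
have a0 u : ~ C0_sequence (sval u) -> a u = 0 by rewrite /a; case: asboolP.
pose k N (u v : Cseq H) : K := a u * (a v)^* *
  ((C0_class (sval u) == C0_class (sval v))%:R *
   \prod_(n < N) <[sval u n, sval v n]>).
apply: (@psd_limit _ _ k) => [N|u v].
  apply: psd_scale; elim: N => [|N IH].
    by apply: psd_ext (psd_class K (fun u : Cseq H => C0_class (sval u))) => u v;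
      rewrite big_ord0 mulr1.
  apply: psd_ext (psd_sum r (fun i => psd_scale
    (fun u : Cseq H => <[sval u N, b N i]>) IH)) => u v.
  by rewrite -mulr_suml -parseval big_ord_recr /=; ring.
have [uv|uv] := pselect [/\ C0_sequence (sval u), C0_sequence (sval v)
    & C0_equiv (sval u) (sval v)].
  have [u0 v0 uve] := uv; have [_ /(_ uve) uvc] := C0_class_eq u0 v0.
  rewrite (_ : (fun N => _) = fun N => \prod_(n < N) <[sval u n, sval v n]>).
    exact: uprod_cvg_seq (C0_equiv_uprod_cvg uve).
  apply/funext => N; rewrite /k (a1 u u0) (a1 v v0).
  by rewrite uvc (eqxx (C0_class (sval v))) conjC1 !mul1r.
have -> : tensor_kernel u v = 0.
  apply: contrapT => /(qprod_hdot_neq0 (svalP u) (svalP v)); exact: uv.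
rewrite (_ : (fun N => _) = cst 0); first exact: cvg_cst.
apply/funext => N; rewrite /k.
have [u0|/a0->] := pselect (C0_sequence (sval u)); last by rewrite !mul0r.
have [v0|/a0->] := pselect (C0_sequence (sval v)); last first.
  by rewrite conjC0 mulr0 !mul0r.
case: eqP => [E|_]; last by rewrite mul0r mulr0.
case: uv; exact: (And3 u0 v0 ((C0_class_eq u0 v0).1 E)).
Qed.

Definition tensor_psd : psd_kernel K (Cseq H) :=
  PsdKernel psd_tensor_kernel.

Let T := rkhs tensor_psd.

Lemma elementary_tensor_kcomb h (Ch : C_sequence h) :
  elementary_tensor h = kcomb tensor_psd [:: (1, exist _ h Ch)].
Proof. by apply/funext => u; rewrite /kcomb big_seq1 mul1r. Qed.

Lemma tensor_span_rkhs : tensor_span (H := H) `<=` rkhs_set tensor_psd.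
Proof.
move=> _ [n [c [a [aE ->]]]]; elim: n c a aE => [|n IH] c a aE.
  rewrite big_ord0 (_ : 0 = kcomb tensor_psd [::]); first exact: kcomb_rkhs.
  by apply/funext => x; rewrite /kcomb big_nil.
rewrite big_ord_recl; apply: rkhs_setP; last by apply: IH => i; apply: aE.
by have [h Ch <-] := aE ord0; rewrite (elementary_tensor_kcomb Ch); apply: kcomb_rkhs.
Qed.

Lemma kcomb_tensor_span l : tensor_span (kcomb tensor_psd l).
Proof.
exists (size l), (fun i => (tnth (in_tuple l) i).1),
  (fun i => elementary_tensor (sval (tnth (in_tuple l) i).2)); split.
  by move=> i; exists (sval (tnth (in_tuple l) i).2) => //; apply: svalP.
apply/funext => x; rewrite /kcomb big_tnth fct_sumE.
by apply: eq_bigr => i _.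
Qed.

Definition tensor_incl (Phi : Cseq H -> K^o) : T := insubd (0 : T) Phi.

Lemma tensor_inclE Phi : rkhs_set tensor_psd Phi -> val (tensor_incl Phi) = Phi.
Proof. by move=> PT; rewrite val_insubd ifT //; apply/asboolP. Qed.

Lemma tensor_incl_linear (a : K) (Phi Psi : Cseq H -> K^o) :
  tensor_span Phi -> tensor_span Psi ->
  tensor_incl (a *: Phi + Psi) = a *: tensor_incl Phi + tensor_incl Psi.
Proof.
move=> /tensor_span_rkhs PT /tensor_span_rkhs PS; apply: val_inj.
transitivity (a *: val (tensor_incl Phi) + val (tensor_incl Psi)); last by [].
apply: (etrans (tensor_inclE (@rkhs_setP _ _ tensor_psd a _ _ PT PS))).
exact: (congr2 (fun x y => a *: x + y) (esym (tensor_inclE PT))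
  (esym (tensor_inclE PS))).
Qed.

Lemma tensor_incl_elementary h (Ch : C_sequence h) :
  tensor_incl (elementary_tensor h) = rkhs_comb tensor_psd [:: (1, exist _ h Ch)].
Proof.
apply: val_inj; rewrite (elementary_tensor_kcomb Ch) tensor_inclE //.
exact: kcomb_rkhs.
Qed.

Lemma tensor_incl_dot h f : C_sequence h -> C_sequence f ->
  <[tensor_incl (elementary_tensor h), tensor_incl (elementary_tensor f)]>
    = qprod (fun n => <[h n, f n]>).
Proof.
move=> Ch Cf; rewrite (tensor_incl_elementary Ch) (tensor_incl_elementary Cf).
by rewrite hdot_rkhs_comb /kpairing big_seq1 conjC1 mul1r /= /kcomb big_seq1 mul1r.
Qed.

Lemma tensor_incl_dense : dense (tensor_incl @` tensor_span (H := H)).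
Proof.
move=> O [g Og] Oo; have : nbhs g O by apply: open_nbhs_nbhs.
move=> /nbhs_ballP[e /= e0 gO].
have e2 : 0 < e / 2 by rewrite divr_gt0.
have [l gl] := rkhs_approx g e2; exists (rkhs_comb tensor_psd l); split.
  apply: gO; rewrite -ball_normE /=; apply: le_lt_trans gl _.
  by rewrite ltr_pdivrMr // mulr_natr mulr2n ltrDl.
exists (kcomb tensor_psd l); first exact: kcomb_tensor_span.
by apply: val_inj; apply: tensor_inclE; apply: kcomb_rkhs.
Qed.

Lemma complete_tensor_exists : inhabited (complete_tensor H).
Proof.
exact: (inhabits (CompleteTensor tensor_incl_linear tensor_incl_dot tensor_incl_dense)).
Qed.

End Existence.

(** * Tensor products of a projection *)

Lemma series_cvg_eventually (R : realType) (v w : nat -> (R[i] : numClosedFieldType)) N :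
  (forall n, 0 <= v n) -> (forall n, 0 <= w n) ->
  (forall n, (N <= n)%N -> v n = w n) -> cvgn (series w) -> cvgn (series v).
Proof.
move=> v0 w0 vw wc; pose c n := if (n < N)%N then v n else 0.
have c0 n : 0 <= c n by rewrite /c; case: ifP.
have cc : cvgn (series c).
  apply/(series_cvgP c0); exists (\sum_(n < N) v n) => M.
  rewrite (bigop_iota _ _ c) (bigop_iota _ _ v) /c -big_mkcond -big_filter.
  apply: sum_uniq_le; rewrite ?filter_uniq ?iota_uniq // => n.
  by rewrite mem_filter !mem_iota /= !add0n => /andP[].
apply: series_cvg_le (series_cvgD wc cc) => n; rewrite v0 /= /c.
by have [nN|/vw->] := ltnP n N; [rewrite lerDr w0|rewrite addr0].
Qed.

Section TensorMaps.
Variables (R : realType) (H : nat -> hilbertType R[i]) (T : complete_tensor H).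
Local Notation K := (R[i] : numClosedFieldType).

Lemma ct_incl0 : ct_incl T 0 = 0.
Proof.
have h := @ct_incl_linear _ _ T 1 0 0 (linear_span0 _) (linear_span0 _).
move: h; rewrite !scale1r addr0 => h.
by apply: (addrI (ct_incl T 0)); rewrite -h addr0.
Qed.

Lemma tens_dense (x : T) (e : K) : 0 < e ->
  exists2 v, linear_span [set tens T h | h in @C_sequence K H] v & `|x - v| < e.
Proof.
move=> e0; have [_ [Phi PhiT <-] xv] := dense_dist (@ct_dense _ _ T) x e0.
exists (ct_incl T Phi); last exact: xv.
move: Phi PhiT {xv}.
have : forall Phi, tensor_span Phi -> tensor_span Phi /\
    linear_span [set tens T h | h in @C_sequence K H] (ct_incl T Phi).
  apply: linear_span_ind => [|a _ Phi [h Ch <-] [PT Ps]].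
    by split; [apply: linear_span0|rewrite ct_incl0; apply: linear_span0].
  have hT : tensor_span (elementary_tensor h).
    rewrite -[elementary_tensor h]scale1r -[_ *: _]addr0.
    by apply: linear_spanS; [exists h|apply: linear_span0].
  split; first by apply: linear_spanS PT; exists h.
  rewrite ct_incl_linear //; apply: linear_spanS Ps; by exists h.
by move=> H0 Phi /H0[].
Qed.

End TensorMaps.

Lemma closure_span_stable (K : numFieldType) (V : normedModType K) (A : set V)
    (L : V -> V) :
  bounded_operator [set: V] L -> (forall x, `|L x| <= `|x|) ->
  (forall x, A x -> A (L x)) ->
  forall x, closure (linear_span A) x -> closure (linear_span A) (L x).
Proof.
move=> [_ Llin _] L1 LA x /closure_distP xA; apply/closure_distP => e /xA[v vA xv].
have LB u w : L u - L w = L (u - w).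
  by rewrite [u - w]addrC -[- w]scaleN1r Llin // scaleN1r addrC.
exists (L v); last by rewrite LB (le_lt_trans (L1 _)).
have : linear_span A v /\ linear_span A (L v); last by case.
move: v vA {xv}; apply: linear_span_ind => [|a u w Au [wA LwA]].
  have L0 : L 0 = 0 by rewrite -[0 in LHS](subrr (0 : V)) -LB subrr.
  by rewrite L0; split; apply: linear_span0.
by rewrite Llin //; split; apply: linear_spanS => //; apply: LA.
Qed.

(** The hypotheses give [t <= 9 / 8] and [`|b| >= 7 / 8], and
    [9 ^ 2 <= 2 * 7 ^ 2]. *)
Lemma half_square_bound (K : numFieldType) (t a b : K) : 0 <= t ->
  `|1 - t| <= 8^-1 -> `|1 - b| <= 8^-1 -> t ^+ 2 = a ^+ 2 + `|b| ^+ 2 ->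
  a ^+ 2 <= 2^-1 * t ^+ 2.
Proof.
set d := 8^-1 => t0 td bd tab; have d0 : 0 <= d by rewrite invr_ge0 ler0n.
have d8 : 1 = 8 * d by rewrite mulfV // pnatr_eq0.
have t9 : `|t| <= 9 * d.
  rewrite -[t](subKr 1) (le_trans (ler_normB _ _)) // normr1.
  by rewrite (_ : 9 * d = 1 + d) ?lerD2l // [X in X + _]d8; ring.
have b7 : 7 * d <= `|b|.
  rewrite -(lerD2r d) (_ : 7 * d + d = 1); last by rewrite [RHS]d8; ring.
  rewrite -[leLHS]normr1 -[X in `|X| <= _](subrK b) addrC.
  by rewrite (le_trans (ler_normD _ _)) // lerD2l.
have t2 : t ^+ 2 <= 81 * d ^+ 2.
  rewrite (_ : 81 * d ^+ 2 = (9 * d) ^+ 2); last by ring.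
  by rewrite ler_pXn2r ?nnegrE ?mulr_ge0 ?ler0n // -[t]ger0_norm.
have b2 : 49 * d ^+ 2 <= `|b| ^+ 2.
  rewrite (_ : 49 * d ^+ 2 = (7 * d) ^+ 2); last by ring.
  by rewrite ler_pXn2r ?nnegrE // mulr_ge0 // ler0n.
rewrite -(lerD2r (`|b| ^+ 2)) -tab.
rewrite {1}(_ : t ^+ 2 = 2^-1 * t ^+ 2 + 2^-1 * t ^+ 2); last by field.
rewrite lerD2l; apply: le_trans b2.
apply: (@le_trans _ _ (2^-1 * (98 * d ^+ 2))).
  rewrite ler_wpM2l ?invr_ge0 ?ler0n // (le_trans t2) // ler_wpM2r ?exprn_ge0 //.
  by rewrite ler_nat.
by rewrite (_ : 2^-1 * _ = 49 * d ^+ 2) //; field.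
Qed.

Lemma half_pow_le (K : numFieldType) k : 2^-1 ^+ k <= k.+1%:R^-1 :> K.
Proof.
rewrite exprVn lef_pV2 ?posrE ?exprn_gt0 ?ltr0Sn // -natrX ler_nat.
exact: ltn_expl.
Qed.

Section Example.
Variables (R : realType) (V : hilbertType R[i]) (e1 e2 : V).
Local Notation K := (R[i] : numClosedFieldType).
Hypothesis e11 : <[e1, e1]> = 1.
Hypothesis e22 : <[e2, e2]> = 1.
Hypothesis parseval : forall x y : V,
  <[x, y]> = <[x, e1]> * <[y, e1]>^* + <[x, e2]> * <[y, e2]>^*.

Let H : nat -> hilbertType R[i] := fun _ => V.

Definition line_proj (x : V) : V := <[x, e1]> *: e1.

(** All factors, finitely many or none are projected, according to [S]; this is
    what the products over finite sets have in common with the full product. *)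
Definition line_proj_on (S : pred nat) (h : forall n, H n) : forall n, H n :=
  fun n => if S n then line_proj (h n) else h n.

Lemma line_proj_dot x y : <[line_proj x, line_proj y]> = <[x, line_proj y]>.
Proof. by rewrite /line_proj hdotZl !hdotZr e11 mulr1 mulrC. Qed.

Lemma normr_e1 : `|e1| = 1.
Proof. by apply/eqP; rewrite -sqrp_eq1 // hdot_normE e11. Qed.

Lemma normr_e2 : `|e2| = 1.
Proof. by apply/eqP; rewrite -sqrp_eq1 // hdot_normE e22. Qed.

Lemma line_proj_le x : `|line_proj x| <= `|x|.
Proof.
by rewrite normrZ normr_e1 mulr1 (le_trans (hdot_cauchy_schwarz _ _)) ?normr_e1 ?mulr1.
Qed.

Lemma line_proj_bounded : bounded_operator [set: V] line_proj.
Proof.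
split=> // [a x y _ _|]; last by exists 1 => x _; rewrite mul1r line_proj_le.
by rewrite /line_proj hdotDl hdotZl scalerDl scalerA.
Qed.

Lemma line_proj_on_le S h n : `|line_proj_on S h n| <= `|h n|.
Proof. by rewrite /line_proj_on; case: ifP => // _; apply: line_proj_le. Qed.

Lemma C_sequence_line_proj_on S h : C_sequence h -> C_sequence (line_proj_on S h).
Proof. by move=> Ch; apply: (C_sequence_dominated Ch) => n; apply: line_proj_on_le. Qed.

Let y : forall n, H n := fun _ => e2.

Lemma C0_sequence_const : C0_sequence y.
Proof.
split.
  exists 1 => s _; under eq_fun do under eq_bigr do rewrite normr_e2 normr1.
  under eq_fun do rewrite big1_eq; exact: cvg_cst.
apply/series_cvgP => [n|]; first exact: normr_ge0.
exists 0 => N; rewrite big1 // => n _.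
by rewrite normr_e2 subrr normr0.
Qed.

Lemma line_proj_half f : C0_sequence f -> C0_equiv f y ->
  exists m, forall n, (m <= n)%N -> `|line_proj (f n)| ^+ 2 <= 2^-1 * `|f n| ^+ 2.
Proof.
move=> [_ fs] fy; have d0 : 0 < 8^-1 :> K by rewrite invr_gt0 ltr0Sn.
have [m1 H1] := summable_tail (fun n => normr_ge0 _) fs d0.
have [m2 H2] := summable_tail (fun n => normr_ge0 _) fy d0.
exists (maxn m1 m2) => n; rewrite geq_max => /andP[n1 n2].
have h1 : `|1 - `|f n| | <= 8^-1.
  have := H1 [:: n] isT; rewrite big_seq1 => h; apply/ltW/h => k.
  by rewrite inE => /eqP->.
have h2 : `|1 - <[f n, e2]>| <= 8^-1.
  have := H2 [:: n] isT; rewrite big_seq1 => h; apply/ltW/h => k.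
  by rewrite inE => /eqP->.
apply: (half_square_bound (normr_ge0 _) h1 h2).
by rewrite normrZ normr_e1 mulr1 hdot_normE (parseval (f n) (f n)) !normCK.
Qed.

Section Tensor.
Variable T : complete_tensor H.

Definition tensor_contraction (S : pred nat) (L : T -> T) :=
  [/\ bounded_operator [set: T] L, forall x, `|L x| <= `|x|
    & forall h, C_sequence h -> L (tens T h) = tens T (line_proj_on S h)].

(** The projections [line_proj] are self-adjoint and idempotent, and so is their
    tensor product on elementary tensors; it is therefore the restriction of
    the orthogonal projection to the closed span of its values. *)
Lemma tensor_line_proj (S : pred nat) : exists L : T -> T, tensor_contraction S L.
Proof.
have [x e e0|u v|L [Lb L1 LE]] := @projection_operator _ T (Cseq H)
  (fun u => tens T (sval u)) (fun u => tens T (line_proj_on S (sval u)))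
  (@invS_small R).
- have [v vs xv] := tens_dense x e0; exists v => //.
  suff -> : range (fun u : Cseq H => tens T (sval u)) =
    [set tens T h | h in @C_sequence K H] by [].
  apply/seteqP; split=> _ [u Cu <-]; first by exists (sval u) => //; apply: svalP.
  by exists (exist _ u Cu).
- have Cu := svalP u; have Cv := svalP v.
  rewrite !ct_inclE //; try by apply: C_sequence_line_proj_on.
  congr (qprod _); apply/funext => n; rewrite /line_proj_on; case: ifP => // _.
  by rewrite line_proj_dot.
by exists L; split=> // h Ch; rewrite (LE (exist _ h Ch)).
Qed.

Let sqr_tens h j : C_sequence h ->
  (fun N => \prod_(n < N + j) `|h n| ^+ 2) @ \oo --> `|tens T h| ^+ 2.
Proof.
move=> Ch; rewrite (cvg_shiftn j (fun N => \prod_(n < N) `|h n| ^+ 2)).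
rewrite hdot_normE ct_inclE //.
have [a ha] := C_sequence_hdot_cvg Ch; rewrite (qprodE ha).
under eq_fun do under eq_bigr do rewrite hdot_normE.
exact: uprod_cvg_seq ha.
Qed.

(** The squared norms of the tensors are limits of products of squared norms of
    the factors, among which [k] are at least halved. *)
Lemma tens_line_proj_decay f : C0_sequence f -> C0_equiv f y ->
  exists m, forall k (S : pred nat), (forall n, (m <= n < m + k)%N -> S n) ->
    `|tens T (line_proj_on S f)| ^+ 2 <= 2^-1 ^+ k * `|tens T f| ^+ 2.
Proof.
move=> f0 fy; have [m Hm] := line_proj_half f0 fy; exists m => k S HS.
have Cf := f0.1; have CSf := C_sequence_line_proj_on S Cf.
pose c n : K := if (m <= n < m + k)%N then 2^-1 else 1.
have cf n : `|line_proj_on S f n| ^+ 2 <= c n * `|f n| ^+ 2.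
  rewrite /c; case: ifP => [mk|_].
    by rewrite /line_proj_on HS //; apply: Hm; case/andP: mk.
  by rewrite mul1r ler_pXn2r ?nnegrE // line_proj_on_le.
have cE N : \prod_(n < N + (m + k)) c n = 2^-1 ^+ k.
  rewrite addnC bigop_iota !iotaD !big_cat /= add0n.
  rewrite big1_seq ?mul1r => [|n]; last first.
    by rewrite mem_iota add0n => /andP[_ /andP[_ nm]]; rewrite /c leqNgt nm.
  rewrite [X in _ * X]big1_seq ?mulr1 => [|n]; last first.
    rewrite mem_iota => /andP[_ /andP[mkn _]].
    by rewrite /c [(n < _)%N]ltnNge mkn andbF.
  rewrite (eq_big_seq (fun=> 2^-1)) => [|n]; last first.
    by rewrite mem_iota /c => ->.
  by rewrite big_const_seq count_predT size_iota iter_mulr_1.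
rewrite -subr_ge0.
have lim : (fun N => 2^-1 ^+ k * \prod_(n < N + (m + k)) `|f n| ^+ 2 -
    \prod_(n < N + (m + k)) `|line_proj_on S f n| ^+ 2) @ \oo -->
    2^-1 ^+ k * `|tens T f| ^+ 2 - `|tens T (line_proj_on S f)| ^+ 2.
  apply: cvgB; last exact: sqr_tens.
  by apply: cvgM; [exact: cvg_cst|exact: sqr_tens].
apply: (cvgn_ge0 lim) => N; rewrite subr_ge0 -(cE N) -big_split.
by apply: ler_prod => n _; rewrite exprn_ge0 ?normr_ge0 //= cf.
Qed.

Lemma tens_line_proj_small f e : C0_sequence f -> C0_equiv f y -> 0 < e ->
  exists F : {fset nat}, forall S : pred nat, (forall n, n \in F -> S n) ->
    `|tens T (line_proj_on S f)| < e.
Proof.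
move=> f0 fy e0; have [m Hm] := tens_line_proj_decay f0 fy.
set B := `|tens T f| in Hm.
have B1 : 0 < B ^+ 2 + 1 by rewrite ltr_wpDl ?exprn_ge0 ?normr_ge0 ?ltr01.
have ep : 0 < e ^+ 2 by rewrite exprn_gt0.
have [k Hk] := invS_small (divr_gt0 ep B1).
exists [fset n | n in iota m k]%fset => S HS.
have mS n : (m <= n < m + k)%N -> S n.
  by move=> mk; apply: HS; rewrite in_fset /= mem_iota.
rewrite -(@ltr_pXn2r _ 2) ?nnegrE ?normr_ge0 ?(ltW e0) //.
apply: le_lt_trans (Hm k S mS) _.
have h1 : 2^-1 ^+ k < e ^+ 2 / (B ^+ 2 + 1).
  exact: le_lt_trans (half_pow_le _ k) (Hk k (leqnn k)).
apply: (@le_lt_trans _ _ (2^-1 ^+ k * (B ^+ 2 + 1))).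
  rewrite ler_wpM2l ?exprn_ge0 ?invr_ge0 ?ler0n // lerDl; exact: ler01.
by rewrite -ltr_pdivlMr.
Qed.

(** [tens_line_proj_small] gives this for the generators; since [F] does not
    depend on [S] or [L] and each [L] is a contraction, it passes to the closed
    span.  Both the net of finite products and the full product are of this
    kind. *)
Lemma tensor_contraction_small (x : T) e : incomplete_tensor y x -> 0 < e ->
  exists F : {fset nat}, forall S L, tensor_contraction S L ->
    (forall n, n \in F -> S n) -> `|L x| < e.
Proof.
move=> /closure_distP xT e0; have ep : 0 < e / 2 by rewrite divr_gt0.
have [v vs xv] := xT _ ep.
suff [F HF] : exists F : {fset nat}, forall S L, tensor_contraction S L ->
    (forall n, n \in F -> S n) -> `|L v| < e / 2.
  exists F => S L LS FS; have [[_ Llin _] L1 _] := LS.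
  rewrite (_ : x = 1 *: (x - v) + v); last by rewrite scale1r subrK.
  rewrite Llin // scale1r (le_lt_trans (ler_normD _ _)) // [ltRHS]splitr.
  by apply: ltrD; [apply: le_lt_trans (L1 _) xv|apply: HF LS FS].
move: (e / 2) ep => {e0 xv} {}e e0; move: v vs e e0.
apply: linear_span_ind => [e e0|a _ w [f [f0 fy] <-] IH e e0].
  exists fset0 => S L [_ L1 _] _.
  by apply: le_lt_trans (L1 0) _; rewrite normr0.
have ep : 0 < e / 2 by rewrite divr_gt0.
have a1 : 0 < `|a| + 1 by rewrite ltr_wpDl ?normr_ge0 ?ltr01.
have [F HF] := tens_line_proj_small f0 fy (divr_gt0 ep a1).
have [F' HF'] := IH _ ep.
exists (F `|` F')%fset => S L LS FS; have [[_ Llin _] _ LE] := LS.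
rewrite Llin // LE; last exact: f0.1.
rewrite (le_lt_trans (ler_normD _ _)) // [ltRHS]splitr; apply: ltr_leD.
  rewrite normrZ.
  apply: (@le_lt_trans _ _ ((`|a| + 1) * `|tens T (line_proj_on S f)|)).
    by rewrite ler_wpM2r ?normr_ge0 // lerDl ler01.
  rewrite mulrC -ltr_pdivlMr //; apply: HF => n nF; apply: FS.
  by rewrite inE nF.
apply/ltW/(HF' S L LS) => n nF; apply: FS; by rewrite inE nF orbT.
Qed.

Lemma tensor_contraction_eq0 L (x : T) : tensor_contraction predT L ->
  incomplete_tensor y x -> L x = 0.
Proof.
move=> LT xT; apply: normr0_eq0; apply: (@eq0_small _ _ 1) => e e0.
rewrite mul1r normr_id; have [F HF] := tensor_contraction_small xT e0.
by apply/ltW/(HF predT).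
Qed.

Lemma C0_line_proj_on (S : pred nat) f N : (forall n, (N <= n)%N -> ~~ S n) ->
  C0_sequence f -> C0_equiv f y ->
  C0_sequence (line_proj_on S f) /\ C0_equiv (line_proj_on S f) y.
Proof.
move=> NS [Cf fs] fy.
have E n : (N <= n)%N -> line_proj_on S f n = f n.
  by move=> /NS Sn; rewrite /line_proj_on (negbTE Sn).
split; first split; first exact: C_sequence_line_proj_on.
  by apply: (@series_cvg_eventually _ _ _ N _ _ _ fs) => n *; rewrite ?normr_ge0 ?E.
by apply: (@series_cvg_eventually _ _ _ N _ _ _ fy) => n *; rewrite ?normr_ge0 ?E.
Qed.

Lemma bounded_operator0 (W : normedModType K) (S : set W) : S 0 ->
  bounded_operator S (fun _ => 0).
Proof.
move=> S0; split=> // [a u w _ _|]; first by rewrite scaler0 addr0.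
by exists 0 => u _; rewrite normr0 mul0r.
Qed.

Lemma incomplete_tensor0 : incomplete_tensor y (0 : T).
Proof. apply: subset_closure; exact: linear_span0. Qed.

Lemma incomplete_line_proj :
  incomplete_tensor_op (fun=> line_proj) y (fun _ : T => 0).
Proof.
have [L LP] := tensor_line_proj predT; have [_ _ LE] := LP.
have zero h : C_sequence h -> incomplete_tensor y (tens T h) ->
    tens T (fun n => line_proj (h n)) = 0.
  by move=> Ch hy; have := LE h Ch; rewrite (tensor_contraction_eq0 LP hy).
split=> [h Ch hy||h Ch hy]; last by rewrite zero.
  split; first exact: (C_sequence_line_proj_on predT).
  rewrite zero //; exact: incomplete_tensor0.
exact: (bounded_operator0 incomplete_tensor0).
Qed.

Lemma strong_limit_line_proj :
  strong_limit_tensor_op (fun=> line_proj) y (fun _ : T => 0).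
Proof.
split; first exact: (bounded_operator0 incomplete_tensor0).
have /choice[B BP] : forall F : {fset nat}, exists L,
    tensor_contraction (fun n => n \in F) L.
  by move=> F; apply: tensor_line_proj.
exists B; split=> [F|x xT].
  have [[_ Blin BM] B1 BE] := BP F; split; last first.
    by move=> h h0 hy; apply: BE; apply: h0.1.
  split=> [x xT|a u w _ _|]; last by have [M HM] := BM; exists M => u _; apply: HM.
    apply: closure_span_stable (B1) _ _ xT; first by have [] := BP F.
    move=> _ [h [h0 hy] <-]; rewrite BE; last exact: h0.1.
    exists (line_proj_on (fun n => n \in F) h); last by [].
    apply: (@C0_line_proj_on _ _ (\max_(n <- F) n).+1 _ h0 hy) => n.
    by apply: contraL => nF; rewrite -leqNgt; apply: leq_bigmax_seq.
  exact: Blin.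
have totallyF := @totally_filter nat.
apply/cvgrPdist_lt => e e0; have [F HF] := tensor_contraction_small xT e0.
exists F => // F' /fsubsetP FF'; rewrite sub0r normrN.
exact: HF (BP F') FF'.
Qed.

Lemma complete_line_proj : exists L : T -> T,
  complete_tensor_op (fun=> line_proj) L /\ exists x, L x <> 0.
Proof.
have [L [Lb L1 LE]] := tensor_line_proj predT; exists L; split.
  split=> [h Ch _||h Ch _]; [split=> // | exact: Lb | exact: LE].
  exact: (C_sequence_line_proj_on predT).
pose h : forall n, H n := fun=> e1.
have h1 : uprod_cvg (fun n => <[h n, h n]>) (1 : K).
  move=> s _; under eq_fun do under eq_bigr do rewrite e11.
  under eq_fun do rewrite big1_eq; exact: cvg_cst.
have Ch : C_sequence h.
  exists 1 => s _; under eq_fun do under eq_bigr do rewrite normr_e1 normr1.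
  under eq_fun do rewrite big1_eq; exact: cvg_cst.
exists (tens T h); rewrite LE // => h0.
have : <[tens T (line_proj_on predT h), tens T (line_proj_on predT h)]> = 0 :> K.
  by rewrite h0 hdot0l.
rewrite (_ : line_proj_on predT h = h).
  by rewrite ct_inclE // (qprodE h1) => /eqP; rewrite oner_eq0.
by apply/funext => n; rewrite /line_proj_on /line_proj e11 scale1r.
Qed.

End Tensor.

Lemma operator_norm_line_proj : operator_norm [set: V] line_proj = 1.
Proof.
rewrite /operator_norm; set S := image _ _.
have ub : ubound S 1.
  move=> _ [x [_ x1] <-]; have := le_trans (line_proj_le x) x1.
  by rewrite lecE => /andP[].
have S1 : S 1.
  exists e1; first by split=> //; rewrite normr_e1.
  by rewrite /line_proj e11 scale1r normr_e1.
apply/eqP; rewrite eq_le; apply/andP; split.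
  by apply: ge_sup => //; exists 1.
by apply: ub_le_sup => //; exists 1.
Qed.

End Example.

Lemma operator_norm0 (R : realType) (V : normedModType R[i]) (S : set V) : S 0 ->
  operator_norm S (fun=> 0) = 0.
Proof.
move=> S0; rewrite /operator_norm (_ : image _ _ = [set 0]) ?sup1 //.
apply/seteqP; split=> [_ [x _ <-]|_ ->]; first by rewrite normr0.
by exists 0; [split; rewrite ?normr0 ?ler01|rewrite normr0].
Qed.

(** In the space of the identity kernel on [bool], inner products with the kernel
    functions are the values at the two points, hence coordinates. *)
Lemma orthonormal_pair (R : realType) : exists (V : hilbertType R[i]) (e1 e2 : V),
  [/\ <[e1, e1]> = 1, <[e2, e2]> = 1
    & forall x y : V,
      <[x, y]> = <[x, e1]> * <[y, e1]>^* + <[x, e2]> * <[y, e2]>^*].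
Proof.
pose K := R[i] : numClosedFieldType.
pose k := PsdKernel (psd_class K (id : bool -> bool)).
pose e b : rkhs k := rkhs_comb k [:: (1, b)].
have eE (x : rkhs k) b : <[x, e b]> = val x b.
  by rewrite hdot_rkhs_comb /kpairing big_seq1 conjC1 mul1r.
have ee b b' : <[e b, e b']> = (b == b')%:R.
  by rewrite eE /= /kcomb big_seq1 mul1r.
exists (rkhs k : hilbertType R[i]), (e true), (e false); split; rewrite ?ee //.
move=> x y.
have yE : y = val y true *: e true + val y false *: e false.
  apply/val_inj/funext => b.
  transitivity (val y true * val (e true) b + val y false * val (e false) b).
    rewrite -(eE (e true) b) -(eE (e false) b) (ee true b) (ee false b).
    by case: b; rewrite /= ?mulr0 ?mulr1 ?addr0 ?add0r.
  by [].
rewrite {1}yE hdotDr !hdotZr (eE y true) (eE y false).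
by rewrite mulrC [X in _ + X]mulrC.
Qed.

Theorem proposition6p6 (R : realType) :
  exists (H : nat -> hilbertType R[i]) (A : forall n, H n -> H n)
         (y : forall n, H n),
    [/\ forall n, bounded_operator [set: H n] (@A n),
        C0_sequence y,
        inhabited (complete_tensor H)
      & forall T : complete_tensor H,
        exists Ay Ahat Ac : T -> T,
        [/\ [/\ incomplete_tensor_op A y Ay,
                strong_limit_tensor_op A y Ahat
              & forall x, incomplete_tensor y x -> Ay x = 0 /\ Ahat x = 0],
            complete_tensor_op A Ac /\ (exists x, Ac x <> 0)
          & exists p : R,
              uprod_cvg (fun n => operator_norm [set: H n] (@A n)) p /\
              operator_norm (incomplete_tensor y) Ay <> p]].
Proof.
have [V [e1 [e2 [e11 e22 parseval]]]] := orthonormal_pair R.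
exists (fun=> V), (fun=> line_proj e1), (fun=> e2); split.
- by move=> _; apply: line_proj_bounded.
- exact: C0_sequence_const.
- apply: (@complete_tensor_exists _ _ bool [:: true; false]
    (fun _ b => if b then e1 else e2)) => n x y.
  by rewrite big_cons big_seq1.
move=> T; have [Ac [AcT Ac0]] := complete_line_proj e11 T.
exists (fun=> 0), (fun=> 0), Ac; split=> //.
  split; [exact: incomplete_line_proj|exact: strong_limit_line_proj|by []].
exists 1; split.
  move=> s _; under eq_fun do under eq_bigr do rewrite operator_norm_line_proj //.
  under eq_fun do rewrite big1_eq; exact: cvg_cst.
rewrite operator_norm0; last exact: incomplete_tensor0.
by apply/eqP; rewrite eq_sym oner_eq0.
Qed.
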